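(* Let $0<\alpha,\beta<1/2$, let $\varepsilon>0$ and let $d>0$ be an integer. Then there exist a random $k\times d$ real matrix $S$ with $k=\Theta\left(\alpha^{-2}\log(1/\beta)\right)$ and sparsity $s=O\left(\alpha^{-1}\log(1/\beta)\right)$ (every column of $S$ has at most $s$ nonzero entries), and a probability distribution $\mathcal{D}$ on $\mathbb{R}$ (which depends on $s$ and $\varepsilon$ but is otherwise independent of $S$), such that the following holds. For $x,y\in\mathbb{R}^d$, let $\eta,\mu\sim\mathcal{D}^k$ be noise vectors drawn independently of each other and of $S$, and define \[ \hat{E}_{SJLT}:=\Vert (Sx+\eta)-(Sy+\mu)\Vert_2^2-\frac{4ks}{\varepsilon^2}. \] Then: 1. $\hat{E}_{SJLT}$ is an unbiased estimator for $\Vert x-y\Vert_2^2$. 2. $\operatorname{Var}\left[\hat{E}_{SJLT}\right]\le \frac{2}{k}\Vert x-y\Vert_2^4+O\left(\frac{s}{\varepsilon^2}\Vert x-y\Vert_2^2+\frac{s^2}{\varepsilon^4}k\right)$. 3. The mechanism mapping $x$ to the sketch $(S,Sx+\eta)$ is $\varepsilon$-differentially private. 4. In a data stream where $x$ is modified by single-coordinate updates $x_j\leftarrow x_j+a$, the sketch $(S,Sx+\eta)$ can be updated in time $O(s)$ per update. 5. $Sx+\eta$ can be computed in time $O(s\Vert x\Vert_0+k)$, and given $Sx+\eta$ and $Sy+\mu$, $\hat{E}_{SJLT}$ can be computed in time $O(k)$.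
   Context: $\Vert x\Vert_0$ is the number of nonzero coordinates of $x$. Two vectors $x,y\in\mathbb{R}^d$ are neighboring if $\Vert x-y\Vert_1\le 1$. A randomized mechanism $\mathcal{M}$ is $(\varepsilon,\delta)$-differentially private if for all neighboring $x,y$ and all (measurable) sets $T$ of outputs, $\Pr[\mathcal{M}(x)\in T]\le e^{\varepsilon}\Pr[\mathcal{M}(y)\in T]+\delta$, the probability being over the randomness of $\mathcal{M}$; $\varepsilon$-differential privacy means $\delta=0$. Running times are in a model where arithmetic operations and drawing one sample from $\mathcal{D}$ take constant time. *)

(* Defs.v *)
From HB Require Import structures.
From mathcomp Require Import all_boot all_order all_algebra.
From mathcomp Require Import all_classical all_reals all_analysis.

Set Implicit Arguments.
Unset Strict Implicit.
Unset Printing Implicit Defensive.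
Import Order.TTheory GRing.Theory Num.Theory.
Import numFieldNormedType.Exports.
Local Open Scope classical_set_scope.
Local Open Scope ring_scope.

Definition measure_mx_display : measure_display -> measure_display.
Proof. exact. Qed.

Section measurable_matrix.
Context {d} {T : sigmaRingType d}.
Variables m n : nat.

(* [mxvec] enumerates the [m * n] entries, so this is the product
   sigma-algebra, generated by the entry maps. *)
Let entries : 'I_(m * n) -> 'M[T]_(m, n) -> T := fun l M => mxvec M ord0 l.

Let mx_set0 : g_sigma_preimage entries set0.
Proof. exact: sigma_algebra0. Qed.

Let mx_setC A : g_sigma_preimage entries A -> g_sigma_preimage entries (~` A).
Proof. exact: sigma_algebraC. Qed.

Let mx_bigcup (F : _^nat) : (forall i, g_sigma_preimage entries (F i)) ->
  g_sigma_preimage entries (\bigcup_i (F i)).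
Proof. exact: sigma_algebra_bigcup. Qed.

HB.instance Definition _ := @isMeasurable.Build (measure_mx_display d)
  'M[T]_(m, n) (g_sigma_preimage entries) mx_set0 mx_setC mx_bigcup.

End measurable_matrix.

Lemma measurable_fun_mx d1 d2 (T1 : measurableType d1) (T2 : measurableType d2)
    m n (f : T1 -> 'M[T2]_(m, n)) :
  (forall i j, measurable_fun [set: T1] (fun x => f x i j)) ->
  measurable_fun [set: T1] f.
Proof.
move=> mf; apply: measurability => //.
move=> _ [B + <-]; rewrite setTI -bigcup_seq => -[l _ [A mA <-]].
case/mxvec_indexP: l => i j; rewrite setTI.
rewrite (_ : _ @^-1` _ = (fun x => f x i j) @^-1` A).
  by rewrite -[X in measurable X]setTI; exact: mf.
by apply/seteqP; split => x /=; rewrite mxvecE.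
Qed.

Lemma measurable_mx_entry d (T : measurableType d) m n (i : 'I_m) (j : 'I_n) :
  measurable_fun [set: 'M[T]_(m, n)] (fun M : 'M[T]_(m, n) => M i j).
Proof.
move=> _ A mA; rewrite setTI; apply: sub_sigma_algebra.
rewrite -bigcup_seq; exists (mxvec_index i j); first exact: mem_index_enum.
by exists A => //; rewrite setTI; apply/seteqP; split => x /=; rewrite mxvecE.
Qed.

Section iid.
Context {R : realType}.

Definition cons_cv n (p : R * 'cV[R]_n) : 'cV[R]_n.+1 :=
  \col_i if unlift ord0 i is Some j then p.2 j ord0 else p.1.

Lemma measurable_cons_cv n : measurable_fun [set: R * 'cV[R]_n] (@cons_cv n).
Proof.
apply: measurable_fun_mx => i j.
under [X in measurable_fun _ X]eq_fun do rewrite mxE.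
case: unliftP => [l _|_]; last exact: measurable_fst.
apply: (@measurableT_comp _ _ _ _ _ _ (fun v : 'cV[R]_n => v l ord0)) => //.
exact: measurable_mx_entry.
Qed.

HB.instance Definition _ n :=
  isMeasurableFun.Build _ _ _ _ (@cons_cv n) (measurable_cons_cv (n := n)).

(* [iid D n] is the [n]-fold product [D^n], as a law on column vectors. *)
Fixpoint iid (D : probability R R) n : probability 'cV[R]_n R :=
  if n is m.+1 then distribution (D \x iid D m)%E (@cons_cv m) else dirac (0 : 'cV[R]_0).

End iid.

Section sketch.
Context {R : realType}.

Definition l1norm n (v : 'cV[R]_n) : R := \sum_i `|v i ord0|.
Definition l2norm n (v : 'cV[R]_n) : R := Num.sqrt (\sum_i v i ord0 ^+ 2).
Definition l0norm n (v : 'cV[R]_n) : nat := #|[pred i | v i ord0 != 0]|.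

Definition neighboring n (x y : 'cV[R]_n) : Prop := l1norm (x - y) <= 1.

(* A randomized mechanism is a family of random variables [M x] on the
   probability space [(W, Pr)] carrying its internal randomness. *)
Definition differentially_private dW (W : measurableType dW)
    (Pr : probability W R) dY (Y : measurableType dY) n
    (M : 'cV[R]_n -> W -> Y) (eps delta : R) : Prop :=
  (forall x, measurable_fun [set: W] (M x)) /\
  forall x y, neighboring x y -> forall A : set Y, measurable A ->
    (Pr (M x @^-1` A) <= (expR eps)%:E * Pr (M y @^-1` A) + delta%:E)%E.

Definition unbiased_estimator dW (W : measurableType dW)
    (Pr : probability W R) (X : W -> R) (theta : R) : Prop :=
  Pr.-integrable [set: W] (EFin \o X) /\ ('E_Pr[X] = theta%:E)%E.

Definition column_sparse k d (s : nat) (S : 'M[R]_(k, d)) : Prop :=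
  forall j, (l0norm (col j S) <= s)%N.

Definition sketch k d (S : 'M[R]_(k, d)) (x : 'cV[R]_d) (eta : 'cV[R]_k) :
  'cV[R]_k := S *m x + eta.

(* The estimator of [`|x - y|_2^2], from the sketches [u] of [x] and [v] of [y]. *)
Definition E_SJLT k (s : nat) (eps : R) (u v : 'cV[R]_k) : R :=
  l2norm (u - v) ^+ 2 - 4 * k%:R * s%:R / eps ^+ 2.

End sketch.

(* A unit-cost real RAM with sampling. Memory consists of arrays of natural
   numbers and arrays of reals, both indexed by an array name and a position;
   natural numbers are the only constants, so a program cannot hide real data
   in its text. *)

Inductive iexp : Type :=
| INat of nat
| IGet of nat & iexp
| IAdd of iexp & iexp
| ISub of iexp & iexp
| IMul of iexp & iexp.

Inductive rexp : Type :=
| RNat of iexp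
| RGet of nat & iexp
| RAdd of rexp & rexp
| RSub of rexp & rexp
| RMul of rexp & rexp
| RDiv of rexp & rexp.

Inductive test : Type :=
| ILt of iexp & iexp
| RLt of rexp & rexp.

Inductive cmd : Type :=
| Skip
| ISet of nat & iexp & iexp
| RSet of nat & iexp & rexp
| Draw of nat & iexp
| Seq of cmd & cmd
| If of test & cmd & cmd
| While of test & cmd.

Section machine.
Context {R : realType}.

(* [tape] lists the results of the samples still to be drawn. *)
Record state := State {
  imem : nat -> nat -> nat;
  rmem : nat -> nat -> R;
  tape : seq R }.

Definition upd (V : Type) (m : nat -> nat -> V) (a i : nat) (v : V) :
    nat -> nat -> V :=
  fun b j => if (b == a) && (j == i) then v else m b j.

Fixpoint ieval (st : state) (e : iexp) : nat :=
  match e with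
  | INat n => n
  | IGet a i => imem st a (ieval st i)
  | IAdd e1 e2 => (ieval st e1 + ieval st e2)%N
  | ISub e1 e2 => (ieval st e1 - ieval st e2)%N
  | IMul e1 e2 => (ieval st e1 * ieval st e2)%N
  end.

Fixpoint reval (st : state) (e : rexp) : R :=
  match e with
  | RNat i => (ieval st i)%:R
  | RGet a i => rmem st a (ieval st i)
  | RAdd e1 e2 => reval st e1 + reval st e2
  | RSub e1 e2 => reval st e1 - reval st e2
  | RMul e1 e2 => reval st e1 * reval st e2
  | RDiv e1 e2 => reval st e1 / reval st e2
  end.

Definition teval (st : state) (b : test) : bool :=
  match b with
  | ILt e1 e2 => (ieval st e1 < ieval st e2)%N
  | RLt e1 e2 => reval st e1 < reval st e2
  end.

End machine.
Arguments state : clear implicits.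

Fixpoint icost (e : iexp) : nat :=
  match e with
  | INat _ => 1
  | IGet _ i => (icost i).+1
  | IAdd e1 e2 | ISub e1 e2 | IMul e1 e2 => (icost e1 + icost e2).+1
  end.

Fixpoint rcost (e : rexp) : nat :=
  match e with
  | RNat i => (icost i).+1
  | RGet _ i => (icost i).+1
  | RAdd e1 e2 | RSub e1 e2 | RMul e1 e2 | RDiv e1 e2 =>
      (rcost e1 + rcost e2).+1
  end.

Definition tcost (b : test) : nat :=
  match b with
  | ILt e1 e2 => (icost e1 + icost e2).+1
  | RLt e1 e2 => (rcost e1 + rcost e2).+1
  end.

(* [exec c st t st']: started in [st], [c] halts in [st'] after [t] unit-cost
   steps. [Draw] blocks on an empty tape. *)
Inductive exec {R : realType} :
  cmd -> state R -> nat -> state R -> Prop :=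
| ExSkip st : exec Skip st 1 st
| ExISet st a i e :
    exec (ISet a i e) st (icost i + icost e).+1
      (State (upd (imem st) a (ieval st i) (ieval st e)) (rmem st) (tape st))
| ExRSet st a i e :
    exec (RSet a i e) st (icost i + rcost e).+1
      (State (imem st) (upd (rmem st) a (ieval st i) (reval st e)) (tape st))
| ExDraw st a i w ws : tape st = w :: ws ->
    exec (Draw a i) st (icost i).+1
      (State (imem st) (upd (rmem st) a (ieval st i) w) ws)
| ExSeq c1 c2 st1 st2 st3 t1 t2 :
    exec c1 st1 t1 st2 -> exec c2 st2 t2 st3 ->
    exec (Seq c1 c2) st1 (t1 + t2)%N st3
| ExIf b c1 c2 st st' t :
    exec (if teval st b then c1 else c2) st t st' ->
    exec (If b c1 c2) st (tcost b + t)%N st'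
| ExWhileF b c st : ~~ teval st b -> exec (While b c) st (tcost b) st
| ExWhileT b c st1 st2 st3 t1 t2 : teval st1 b ->
    exec c st1 t1 st2 -> exec (While b c) st2 t2 st3 ->
    exec (While b c) st1 (tcost b + t1 + t2)%N st3.

Definition runs_within {R : realType} (c : cmd) (st : state R) (bound : nat)
    (post : state R -> Prop) : Prop :=
  exists t st', [/\ exec c st t st', (t <= bound)%N & post st'].

(* Natural-number arrays. *)
Definition aK := 0%N.      (* number of rows of S, at position 0 *)
Definition aS := 1%N.      (* sparsity s, at position 0 *)
Definition aCount := 2%N.  (* number of nonzero entries of each column of S *)
Definition aRow := 3%N.    (* their rows *)
Definition aXSize := 4%N.  (* number of nonzero coordinates of x, at position 0 *)
Definition aXIdx := 5%N.   (* their indices *)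
Definition aJ := 6%N.      (* updated coordinate, at position 0 *)

(* Real arrays. *)
Definition aVal := 0%N.    (* the nonzero entries of S *)
Definition aXVal := 1%N.   (* the nonzero coordinates of x *)
Definition aA := 2%N.      (* increment of an update, at position 0 *)
Definition aU := 3%N.      (* first sketch *)
Definition aV := 4%N.      (* second sketch *)
Definition aEps := 5%N.    (* epsilon, at position 0 *)
Definition aOut := 6%N.    (* value of the estimator, at position 0 *)

Section layout.
Context {R : realType}.

Definition holds_vector n (st : state R) (a : nat) (v : 'cV[R]_n) : Prop :=
  forall i : 'I_n, rmem st a i = v i ord0.

(* [v] is given as the list, in any order, of its nonzero coordinates. *)
Definition sparse_vector n (v : 'cV[R]_n) (size_v : nat) (idx : nat -> nat)
    (value : nat -> R) : Prop :=
  exists l : seq 'I_n,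
    [/\ uniq l, l =i [pred i | v i ord0 != 0],
        mkseq idx size_v = [seq val i | i <- l]
      & mkseq value size_v = [seq v i ord0 | i <- l]].

(* [S] is stored by columns, column [j] occupying the positions
   [j * s, ..., j * s + s - 1]. *)
Definition holds_matrix k d (st : state R) (s : nat) (S : 'M[R]_(k, d)) : Prop :=
  [/\ imem st aK 0 = k, imem st aS 0 = s
    & forall j : 'I_d, sparse_vector (col j S) (imem st aCount j)
        (fun t => imem st aRow (j * s + t)%N)
        (fun t => rmem st aVal (j * s + t)%N)].

Definition holds_sparse_input n (st : state R) (x : 'cV[R]_n) : Prop :=
  sparse_vector x (imem st aXSize 0) (imem st aXIdx) (rmem st aXVal).

Definition holds_sketch k d (st : state R) (s : nat) (S : 'M[R]_(k, d))
    (u : 'cV[R]_k) : Prop :=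
  holds_matrix st s S /\ holds_vector st aU u.

(* [(S, S x + eta)] becomes [(S, S (x + a e_j) + eta)]. *)
Definition updates_sketch_within (update : cmd) (bound : nat) k d (s : nat)
    (S : 'M[R]_(k, d)) : Prop :=
  forall (x : 'cV[R]_d) (eta : 'cV[R]_k) (j : 'I_d) (a : R) (st : state R),
    holds_sketch st s S (sketch S x eta) ->
    imem st aJ 0 = j -> rmem st aA 0 = a ->
    runs_within update st bound
      (fun st' => holds_sketch st' s S
                    (sketch S (x + a *: delta_mx j ord0) eta)).

(* The samples available on the tape are exactly the coordinates of [eta]. *)
Definition computes_sketch_within (compute : cmd) k d
    (bound : 'cV[R]_d -> nat) (s : nat) (S : 'M[R]_(k, d)) : Prop :=
  forall (x : 'cV[R]_d) (eta : 'cV[R]_k) (st : state R),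
    holds_matrix st s S -> holds_sparse_input st x ->
    tape st = [seq eta i ord0 | i <- enum 'I_k] ->
    runs_within compute st (bound x)
      (fun st' => holds_sketch st' s S (sketch S x eta)).

Definition computes_estimator_within (estimate : cmd) (bound : nat) k d
    (s : nat) (eps : R) (S : 'M[R]_(k, d)) : Prop :=
  forall (x y : 'cV[R]_d) (eta mu : 'cV[R]_k) (st : state R),
    imem st aK 0 = k -> imem st aS 0 = s -> rmem st aEps 0 = eps ->
    holds_vector st aU (sketch S x eta) ->
    holds_vector st aV (sketch S y mu) ->
    runs_within estimate st bound
      (fun st' => rmem st' aOut 0 =
         E_SJLT s eps (sketch S x eta) (sketch S y mu)).

End layout.

(* Main.v *)
(** A sparsity of 1 suffices: [alpha, beta < 1/2] give [alpha^-1 * ln (1/beta) >= 1].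
    So [S] is a Count-Sketch, each column being a uniformly random signed unit
    vector, and [D] is the Laplace law of scale [sqrt s / eps].

    Adding a column [sigma e_h] to a sketch turns [|S z|^2] into
    [z_0^2 + 2 sigma z_0 (S z)_h + |S z|^2]; averaging over [sigma] and [h] gives, by
    induction on the number of columns, [E |S z|^2 = |z|^2] and
    [E |S z|^4 <= (1 + 2/k) |z|^4].  The moments of [|v + eta|^2] follow in the same
    way by induction on the number of coordinates of the noise.

    The log-density of [D] is [eps / sqrt s]-Lipschitz, so translating the noise by
    [S (x - y)] costs, for [s = 1], a factor at most [exp (eps * |S (x - y)|_1)], and
    [|S z|_1 <= |z|_1] as the columns of [S] have l1-norm 1. *)

From HB Require Import structures.
Require Import Defs.
From mathcomp Require Import all_boot all_order all_algebra.
From mathcomp Require Import all_classical all_reals all_analysis.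
From mathcomp Require Import measurable_realfun zify ring lra.
Set Implicit Arguments.
Unset Strict Implicit.
Unset Printing Implicit Defensive.
Import Order.TTheory GRing.Theory Num.Theory.
Import numFieldNormedType.Exports HBNNSimple.
Local Open Scope classical_set_scope.
Local Open Scope ring_scope.

(** * Laplace noise *)

(** Every moment is computed as the extended-real integral of a nonnegative function, so Tonelli and
    additivity apply without integrability conditions, and an explicit finite value carries the
    finiteness along. The price is that no cross term may be integrated on its own: odd powers are
    removed by symmetrization or by pairing a signed unit with its opposite before anything is
    split.

    The second and fourth moments of the noise are stated around an arbitrary centre [c]. This is
    what allows adding the noise one coordinate at a time, then adding the second noise around the
    first, and finally randomizing the centre through [S]. As [S] is uniform on a finite list, its
    own moments are plain finite sums.

    For privacy, [S] is part of the output but its law does not depend on the input, so the bound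
    may be proved for each fixed value of [S] and then integrated. *)

(** For an indicator this is the description of [nu]; linearity extends it to simple functions, and
    monotone convergence to their increasing limits. *)
Lemma ge0_integral_density d (T : measurableType d) (R : realType)
    (mu nu : {measure set T -> \bar R}) (p : T -> R) (f : T -> \bar R) :
  measurable_fun [set: T] p -> (forall x, 0 <= p x) ->
  (forall A, measurable A -> nu A = (\int[mu]_(x in A) (p x)%:E)%E) ->
  measurable_fun [set: T] f -> (forall x, (0 <= f x)%E) ->
  (\int[nu]_x f x = \int[mu]_x (f x * (p x)%:E))%E.
Proof.
move=> mp p0 nuE mf f0.
have mpE : measurable_fun [set: T] (EFin \o p) by exact/measurable_EFinP.
pose h := nnsfun_approx measurableT mf.
have cvh x : (h n x)%:E @[n --> \oo] --> f x by exact: cvg_nnsfun_approx.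
have ndh x : {homo (fun n => (h n x)%:E) : a b / (a <= b)%N >-> (a <= b)%E}.
  by move=> a b ab; rewrite lee_fin; exact/lefP/nd_nnsfun_approx.
have mh n : measurable_fun [set: T] (EFin \o h n) by exact/measurable_EFinP.
transitivity (limn (fun n => \int[nu]_x (h n x)%:E)%E).
  rewrite -monotone_convergence//=.
  - by apply: eq_integral => x _; apply/esym/cvg_lim.
  - by move=> n x _; rewrite lee_fin.
transitivity (limn (fun n => \int[mu]_x ((h n x)%:E * (p x)%:E))%E); last first.
  rewrite -monotone_convergence//=.
  - by apply: eq_integral => x _; apply/cvg_lim => //; exact: cvgeZr.
  - by move=> n; exact: (emeasurable_funM (mh n) mpE).
  - by move=> n x _; rewrite mule_ge0// lee_fin.
  - by move=> x _ a b ab; rewrite lee_wpmul2r ?lee_fin//; exact/lefP/nd_nnsfun_approx.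
congr (limn _); apply/funext => n.
under eq_integral do rewrite fimfunE -fsumEFin//.
rewrite ge0_integral_fsum//; last 2 first.
  - by move=> r; exact/measurable_EFinP/measurableT_comp.
  - by move=> r x _; rewrite EFinM nnfun_muleindic_ge0.
under [RHS]eq_integral.
  move=> x _; rewrite fimfunE -fsumEFin// ge0_mule_fsuml; last first.
    by move=> r; rewrite EFinM nnfun_muleindic_ge0.
  over.
rewrite [RHS]ge0_integral_fsum//; last 2 first.
  - move=> r; apply: emeasurable_funM => //.
    exact/measurable_EFinP/measurableT_comp.
  - by move=> r x _; rewrite mule_ge0 ?(EFinM, nnfun_muleindic_ge0) ?lee_fin.
apply: eq_fsbigr => r; rewrite inE => -[t _ hr].
rewrite integralZl_indic_nnsfun// integral_indic// setIT nuE//.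
have r0 : 0 <= r by rewrite -hr.
under [RHS]eq_integral do rewrite EFinM -muleA.
rewrite ge0_integralZl ?lee_fin//; last 2 first.
  - by apply: emeasurable_funM => //; exact/measurable_EFinP.
  - by move=> x _; rewrite mule_ge0// lee_fin.
congr (_ * _)%E; rewrite integral_mkcond; apply: eq_integral => x _.
rewrite patchE indicE; case: ifPn => _; by rewrite ?mul1e ?mul0e.
Qed.

(** The pushforward of Lebesgue measure by the translation gives half-open intervals their length,
    so uniqueness identifies it with Lebesgue measure. *)
Lemma ge0_integral_translate (R : realType) (v : R) (f : R -> \bar R) :
  measurable_fun [set: R] f -> (forall x, (0 <= f x)%E) ->
  (\int[lebesgue_measure]_x f (v + x)%R = \int[lebesgue_measure]_x f x)%E.
Proof.
move=> mf f0.
pose t : measurableTypeR R -> measurableTypeR R := fun x => v + x.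
have mt : measurable_fun [set: measurableTypeR R] t by exact: measurable_funD.
pose tm : {mfun measurableTypeR R >-> measurableTypeR R} :=
  HB.pack t (isMeasurableFun.Build _ _ _ _ t mt).
transitivity (\int[pushforward lebesgue_measure tm]_x f x)%E.
  by rewrite ge0_integral_pushforward.
apply: eq_measure_integral => A mA _; apply/esym/lebesgue_measure_unique => //.
move=> _ [[a b]] _ <-.
transitivity (lebesgue_measure `](a - v), (b - v)]%classic); last first.
  congr (lebesgue_measure _); apply/seteqP.
  by split=> x /=; rewrite /t !in_itv/= ltrBlDl lerBrDl.
rewrite !lebesgue_measure_itv/= !lte_fin ltrD2r.
by case: ifP => // _; rewrite -!EFinB; congr EFin; ring.
Qed.

(* [- exp_antideriv_poly n x * expR (- x)] is an antiderivative of
   [x ^+ n * expR (- x)]. *)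
Fixpoint exp_antideriv_poly {R : realType} n (x : R) : R :=
  if n is m.+1 then x ^+ n + n%:R * exp_antideriv_poly m x else 1.

Lemma exp_antideriv_poly0 (R : realType) n : exp_antideriv_poly n 0 = n`!%:R :> R.
Proof. by elim: n => //= n ->; rewrite expr0n add0r factS natrM. Qed.

Lemma is_derive_exp_antideriv_poly (R : realType) n (x : R) :
  is_derive x 1 (@exp_antideriv_poly R n) (exp_antideriv_poly n x - x ^+ n).
Proof.
elim: n => [|n IHn]; first by rewrite subrr; exact: is_derive_cst.
have D := is_deriveD (is_deriveX n.+1 (is_derive_id x 1)) (is_deriveZ n.+1%:R IHn).
have E : @exp_antideriv_poly R n.+1 =
    id ^+ n.+1 + n.+1%:R \*: exp_antideriv_poly n.
  by apply/funext => y; rewrite !fctE.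
by rewrite E; apply: is_derive_eq; rewrite -E /GRing.scale/=; ring.
Qed.

(** The inequality [x ^+ n.+1 / n.+1! <= expR x] bounds the product by a multiple of [x^-1]. *)
Lemma cvg_exprn_expRN (R : realType) n :
  x ^+ n * expR (- x) @[x --> +oo] --> (0 : R).
Proof.
apply: (@squeeze_cvgr _ _ _ R (cst 0) (fun x => n.+1`!%:R * x^-1)).
- near=> x.
  have x0 : 0 < x by near: x; exact: nbhs_pinfty_gt.
  rewrite /= mulr_ge0 ?expR_ge0 ?exprn_ge0 ?(ltW x0)//=.
  rewrite expRN ler_pdivrMr ?expR_gt0// mulrAC ler_pdivlMr// -exprSr.
  rewrite -ler_pdivrMl ?ltr0n ?fact_gt0// mulrC.
  by rewrite (le_trans _ (expR_ge1Dxn n (ltW x0)))// lerDr.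
- exact: cvg_cst.
- rewrite -[X in _ --> X](mulr0 n.+1`!%:R); apply: cvgM; first exact: cvg_cst.
  by apply/(gtr0_cvgV0 (f := id)); [exact: nbhs_pinfty_gt|exact: cvg_id].
Unshelve. all: by end_near. Qed.

Lemma cvg_exp_antideriv_poly (R : realType) n :
  exp_antideriv_poly n x * expR (- x) @[x --> +oo] --> (0 : R).
Proof.
elim: n => [|n IHn].
  by have := @cvg_exprn_expRN R 0; under eq_cvg do rewrite expr0.
under eq_cvg do rewrite /= mulrDl -mulrA.
have := cvgD (@cvg_exprn_expRN R n.+1) (cvgM (cvg_cst (n.+1%:R : R)) IHn).
by rewrite mulr0 addr0; apply.
Qed.

Lemma integral_exprn_expRN (R : realType) n :
  (\int[lebesgue_measure]_(x in [set x : R | (0 <= x)%R]) (x ^+ n * expR (- x))%:E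
   = n`!%:R%:E)%E.
Proof.
pose F (x : R) := - (exp_antideriv_poly n x * expR (- x)).
have dF (x : R) : is_derive x 1 F (x ^+ n * expR (- x)).
  have dq := is_derive_exp_antideriv_poly n x.
  apply: is_derive_eq; rewrite /GRing.scale/=; ring.
have cF : continuous F.
  by move=> x; apply/differentiable_continuous/derivable1_diffP; apply: ex_derive.
rewrite -set_itvcy (@ge0_continuous_FTC2y _ _ F 0 0)//.
- by rewrite /F exp_antideriv_poly0 oppr0 expR0 mulr1 EFinN oppeK add0e.
- by move=> x x0; rewrite mulr_ge0 ?expR_ge0 ?exprn_ge0.
- apply: continuous_subspaceT => x; apply: cvgM; first exact: exprn_continuous.
  by apply: (@continuous_comp _ _ _ -%R); [exact: opp_continuous|exact: continuous_expR].
- by rewrite -oppr0; apply: cvgN; exact: cvg_exp_antideriv_poly.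
- by apply: cvg_at_right_filter; exact: cF.
- by move=> x _; rewrite derive1E derive_val.
Qed.

Section laplace.
Context {R : realType}.
Local Notation mu := (@lebesgue_measure R).

Definition laplace_pdf (x : R) : R := expR (- `|x|) / 2.

Lemma laplace_pdf_ge0 x : 0 <= laplace_pdf x.
Proof. by rewrite divr_ge0 ?expR_ge0. Qed.

Lemma continuous_laplace_pdf : continuous laplace_pdf.
Proof.
move=> x; apply: cvgM; last exact: cvg_cst.
apply: (cvg_comp _ expR); last exact: continuous_expR.
by apply: cvgN; exact: norm_continuous.
Qed.

Lemma measurable_laplace_pdf : measurable_fun [set: R] laplace_pdf.
Proof. by apply: continuous_measurable_fun; exact: continuous_laplace_pdf. Qed.

(** By evenness the integral is twice the one over the half-line, which cancels the [1 / 2] of the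
    density. Odd [n] would give an integrand of varying sign, outside the nonnegative calculus used
    here. *)
Lemma integral_even_laplace_pdf n : ~~ odd n ->
  (\int[mu]_x (x ^+ n * laplace_pdf x)%:E = n`!%:R%:E)%E.
Proof.
move=> en; have mI : measurable [set x : R | 0 <= x] by rewrite -set_itvcy.
rewrite ge0_symfun_integralT.
- rewrite (_ : \int[mu]_(x in _) _ = \int[mu]_(x in [set x : R | (0 <= x)%R])
      (2^-1%:E * (x ^+ n * expR (- x))%:E))%E; last first.
    apply: eq_integral => x; rewrite inE/= => x0.
    by rewrite -EFinM /laplace_pdf ger0_norm//; congr EFin; ring.
  rewrite ge0_integralZl_EFin//=.
  + rewrite integral_exprn_expRN -!EFinM mulrA divff ?mul1r//.
  + by move=> x x0; rewrite lee_fin mulr_ge0 ?expR_ge0 ?exprn_ge0.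
  + apply/measurable_EFinP/measurable_funTS; apply: measurable_funM.
      exact: exprn_measurable.
    by apply: measurableT_comp => //; exact: measurableT_comp.
- by move=> x; rewrite mulr_ge0 ?laplace_pdf_ge0 ?exprn_even_ge0//.
- move=> x; apply: cvgM; first exact: exprn_continuous.
  exact: continuous_laplace_pdf.
- by move=> x /=; rewrite /laplace_pdf normrN exprNn -signr_odd (negbTE en) mul1r.
Qed.

(* Lebesgue measure lives on [measurableTypeR R], which differs from [R] by its
   display; [dilation] below brings the law back to [R]. *)
Definition laplace_prob (A : set (measurableTypeR R)) : \bar R :=
  (\int[mu]_(x in A) (laplace_pdf x)%:E)%E.

Let laplace0 : laplace_prob set0 = 0%E.
Proof. exact: integral_set0. Qed.

Let laplace_ge0 A : (0 <= laplace_prob A)%E.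
Proof. by apply: integral_ge0 => x _; rewrite lee_fin laplace_pdf_ge0. Qed.

Let laplace_sigma_additive : semi_sigma_additive laplace_prob.
Proof.
move=> F mF tF mUF; rewrite /laplace_prob; apply: cvg_toP.
  apply: ereal_nondecreasing_is_cvgn => m n mn.
  apply: lee_sum_nneg_natr => // k _ _; apply: integral_ge0 => /= x Fkx.
  by rewrite lee_fin laplace_pdf_ge0.
rewrite ge0_integral_bigcup//=.
- apply/measurable_funTS/measurableT_comp => //; exact: measurable_laplace_pdf.
- by move=> x _; rewrite lee_fin laplace_pdf_ge0.
Qed.

HB.instance Definition _ := isMeasure.Build _ _ _
  laplace_prob laplace0 laplace_ge0 laplace_sigma_additive.

Let laplace_setT : laplace_prob [set: R] = 1%E.
Proof.
rewrite /laplace_prob -[RHS](@integral_even_laplace_pdf 0)//.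
by apply: eq_integral => x _; rewrite expr0 mul1r.
Qed.

HB.instance Definition _ :=
  @Measure_isProbability.Build _ _ R laplace_prob laplace_setT.

Lemma ge0_integral_laplace (f : R -> \bar R) :
  measurable_fun [set: R] f -> (forall x, (0 <= f x)%E) ->
  (\int[laplace_prob]_x f x = \int[mu]_x (f x * (laplace_pdf x)%:E))%E.
Proof.
move=> mf f0; apply: (@ge0_integral_density _ _ _ mu laplace_prob) => //.
exact: measurable_laplace_pdf.
exact: laplace_pdf_ge0.
Qed.

Lemma laplace_even_moment n : ~~ odd n ->
  (\int[laplace_prob]_x (x ^+ n)%:E = n`!%:R%:E)%E.
Proof.
move=> en; rewrite ge0_integral_laplace.
- by rewrite -integral_even_laplace_pdf//; under eq_integral do rewrite -EFinM.
- by apply/measurable_EFinP; exact: exprn_measurable.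
- by move=> x; rewrite lee_fin exprn_even_ge0.
Qed.

Lemma laplace_symmetric (f : R -> \bar R) :
  measurable_fun [set: R] f -> (forall x, (0 <= f x)%E) ->
  (\int[laplace_prob]_x f (- x)%R = \int[laplace_prob]_x f x)%E.
Proof.
move=> mf f0; have mfN : measurable_fun [set: R] (f \o -%R) by exact: measurableT_comp.
rewrite !ge0_integral_laplace//.
pose g x := (f x * (laplace_pdf x)%:E)%E.
have mg : measurable_fun [set: R] g.
  apply: emeasurable_funM => //; apply/measurable_EFinP.
  exact: measurable_laplace_pdf.
pose t : measurableTypeR R -> measurableTypeR R := -%R.
have mt : measurable_fun [set: measurableTypeR R] t by exact: oppr_measurable.
pose tm : {mfun measurableTypeR R >-> measurableTypeR R} :=
  HB.pack t (isMeasurableFun.Build _ _ _ _ t mt).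
transitivity (\int[pushforward mu tm]_x g x)%E.
  rewrite (ge0_integral_pushforward mt mu measurableT mg); last first.
    by move=> x _; rewrite mule_ge0// lee_fin laplace_pdf_ge0.
  by apply: eq_integral => x _; rewrite /g/= /laplace_pdf normrN.
by apply: eq_measure_integral => A mA _; exact: lebesgue_measureN.
Qed.

Lemma laplace_translate_le (v : R) (f : R -> \bar R) :
  measurable_fun [set: R] f -> (forall x, (0 <= f x)%E) ->
  (\int[laplace_prob]_x f (v + x)%R <=
   (expR `|v|)%:E * \int[laplace_prob]_x f x)%E.
Proof.
move=> mf f0.
have mp : measurable_fun [set: R] (EFin \o laplace_pdf).
  by apply/measurable_EFinP; exact: measurable_laplace_pdf.
have mfv : measurable_fun [set: R] (fun x => f (v + x)).
  by apply: measurableT_comp => //; exact: measurable_funD.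
have mpv : measurable_fun [set: R] (fun x => laplace_pdf (v + x)).
  apply: measurableT_comp; first exact: measurable_laplace_pdf.
  exact: measurable_funD.
rewrite !ge0_integral_laplace//.
(* Shifting the variable on the right puts [f (v + x)] on both sides; what remains is the pointwise
   comparison of [laplace_pdf x] with [laplace_pdf (v + x)], by the triangle inequality. *)
rewrite -(@ge0_integral_translate _ v
  (fun x => f x * (laplace_pdf x)%:E)%E); last 2 first.
- exact: emeasurable_funM.
- by move=> x; rewrite mule_ge0// lee_fin laplace_pdf_ge0.
rewrite -ge0_integralZl_EFin ?expR_ge0//; last 2 first.
- by move=> x _; rewrite mule_ge0// lee_fin laplace_pdf_ge0.
- by apply: emeasurable_funM => //; exact/measurable_EFinP.
apply: ge0_le_integral => //.
- by move=> x _; rewrite mule_ge0// lee_fin laplace_pdf_ge0.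
- exact: emeasurable_funM.
- apply: measurable_funeM; apply: emeasurable_funM => //; exact/measurable_EFinP.
- move=> x _; rewrite muleCA lee_wpmul2l// -EFinM lee_fin.
  rewrite /laplace_pdf mulrA -expRD ler_wpM2r// ler_expR.
  by have := ler_normD v x; lra.
Qed.

End laplace.

(** * Moments and translations of product noise *)

(** Reads the sign of a closed-form moment off the fact that it is an integral; this supplies the
    sign conditions of [integral_lincomb] when [m2] and [m4] are only known through their moment
    equations. *)
Lemma integral_fin_ge0 d (T : measurableType d) (R : realType)
    (mu : {measure set T -> \bar R}) (f : T -> R) (a : R) :
  (forall x, 0 <= f x) -> (\int[mu]_x (f x)%:E = a%:E)%E -> 0 <= a.
Proof.
by move=> f0 fa; rewrite -lee_fin -fa; apply: integral_ge0 => x _; rewrite lee_fin.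
Qed.

(** The shape common to all moment computations below: each integrand is first rearranged into this
    form, with nonnegative pieces, and the known values are then substituted. *)
Lemma integral_lincomb d (T : measurableType d) (R : realType)
    (P : probability T R) (f g : T -> R) (a b p q : R) :
  measurable_fun [set: T] f -> (forall x, 0 <= f x) ->
  measurable_fun [set: T] g -> (forall x, 0 <= g x) ->
  0 <= p -> 0 <= q ->
  (\int[P]_x (f x)%:E = a%:E)%E -> (\int[P]_x (g x)%:E = b%:E)%E ->
  (\int[P]_x (f x + p * g x + q)%:E = (a + p * b + q)%:E)%E.
Proof.
move=> mf f0 mg g0 p0 q0 fa gb.
have mpg : measurable_fun [set: T] (fun x => p * g x) by exact: measurable_funM.
under eq_integral do rewrite !EFinD.
rewrite ge0_integralD//=.
- rewrite ge0_integralD//=.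
  + under [X in (_ + X + _)%E]eq_integral do rewrite EFinM.
    rewrite ge0_integralZl_EFin//=.
    * rewrite fa gb integral_cst//= probability_setT mule1.
      by rewrite -EFinM -!EFinD.
    * by move=> x _; rewrite lee_fin.
    * exact/measurable_EFinP.
  + by move=> x _; rewrite lee_fin.
  + exact/measurable_EFinP.
  + by move=> x _; rewrite lee_fin mulr_ge0.
  + exact/measurable_EFinP.
- by move=> x _; rewrite -EFinD lee_fin addr_ge0 ?mulr_ge0.
- by apply: emeasurable_funD; exact/measurable_EFinP.
Qed.

Section column_vectors.
Context {R : realType}.

(** Working with the squared norm keeps all the moments polynomial in the coordinates. *)
Definition sqnorm k (v : 'cV[R]_k) : R := \sum_i v i ord0 ^+ 2.

Lemma sqnorm_ge0 k (v : 'cV[R]_k) : 0 <= sqnorm v.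
Proof. by apply: sumr_ge0 => i _; exact: sqr_ge0. Qed.

Lemma l2norm_sqr k (v : 'cV[R]_k) : l2norm v ^+ 2 = sqnorm v.
Proof. by rewrite sqr_sqrtr// sqnorm_ge0. Qed.

Lemma sqnormN k (v : 'cV[R]_k) : sqnorm (- v) = sqnorm v.
Proof. by apply: eq_bigr => i _; rewrite mxE sqrrN. Qed.

Definition behead_cv k (v : 'cV[R]_k.+1) : 'cV[R]_k := \col_i v (lift ord0 i) ord0.

Lemma add_cons_cv k (v : 'cV[R]_k.+1) (p : R * 'cV[R]_k) :
  v + cons_cv p = cons_cv (v ord0 ord0 + p.1, behead_cv v + p.2).
Proof.
apply/matrixP => i j; rewrite ord1 !mxE.
by case: unliftP => [l ->|->] //=; rewrite !mxE.
Qed.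

Lemma sqnorm_cons_cv k (p : R * 'cV[R]_k) :
  sqnorm (cons_cv p) = p.1 ^+ 2 + sqnorm p.2.
Proof.
rewrite /sqnorm big_ord_recl !mxE unlift_none; congr (_ + _).
by apply: eq_bigr => i _; rewrite !mxE liftK.
Qed.

Lemma sqnormS k (v : 'cV[R]_k.+1) :
  sqnorm v = v ord0 ord0 ^+ 2 + sqnorm (behead_cv v).
Proof.
by rewrite /sqnorm big_ord_recl; congr (_ + _); apply: eq_bigr => i _; rewrite mxE.
Qed.

Lemma l1normS k (v : 'cV[R]_k.+1) :
  l1norm v = `|v ord0 ord0| + l1norm (behead_cv v).
Proof.
by rewrite /l1norm big_ord_recl; congr (_ + _); apply: eq_bigr => i _; rewrite mxE.
Qed.

Lemma measurable_mxD d (T : measurableType d) m n (f g : T -> 'M[R]_(m, n)) :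
  measurable_fun [set: T] f -> measurable_fun [set: T] g ->
  measurable_fun [set: T] (fun x => f x + g x).
Proof.
move=> mf mg; apply: measurable_fun_mx => i j.
under [X in measurable_fun _ X]eq_fun do rewrite mxE.
by apply: measurable_funD; apply: (measurableT_comp (measurable_mx_entry i j)).
Qed.

Lemma measurable_sqnorm d (T : measurableType d) k (f : T -> 'cV[R]_k) :
  measurable_fun [set: T] f -> measurable_fun [set: T] (fun x => sqnorm (f x)).
Proof.
move=> mf; apply: measurable_sum => i; apply: measurable_funX.
exact: (measurableT_comp (measurable_mx_entry i ord0)).
Qed.

Lemma measurable_sqnorm_shift k (v : 'cV[R]_k) :
  measurable_fun [set: 'cV[R]_k] (fun y => sqnorm (v + y)).
Proof. by apply: measurable_sqnorm; exact: measurable_mxD. Qed.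

End column_vectors.

Section iid_noise.
Context {R : realType} (D : probability R R).

Lemma ge0_integral_iidS k (f : 'cV[R]_k.+1 -> \bar R) :
  measurable_fun [set: 'cV[R]_k.+1] f -> (forall y, (0 <= f y)%E) ->
  (\int[iid D k.+1]_y f y = \int[D]_x \int[iid D k]_y f (cons_cv (x, y)))%E.
Proof.
move=> mf f0; rewrite ge0_integral_distribution// fubini_tonelli1//=.
by apply: measurableT_comp => //; exact: measurable_cons_cv.
Qed.

Section moments.
Variables m2 m4 : R.
Hypothesis moment2 : forall c, (\int[D]_x ((c + x) ^+ 2)%:E = (c ^+ 2 + m2)%:E)%E.
Hypothesis moment4 : forall c,
  (\int[D]_x ((c + x) ^+ 4)%:E = (c ^+ 4 + 6 * c ^+ 2 * m2 + m4)%:E)%E.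

Let measurable_shiftX c n : measurable_fun [set: R] (fun x => (c + x) ^+ n).
Proof. by apply: measurable_funX; exact: measurable_funD. Qed.

Lemma iid_moment2 k (v : 'cV[R]_k) :
  (\int[iid D k]_y (sqnorm (v + y))%:E = (sqnorm v + k%:R * m2)%:E)%E.
Proof.
elim: k v => [|k IHk] v.
  under eq_integral do rewrite /sqnorm big_ord0.
  by rewrite integral0 /sqnorm big_ord0 mul0r addr0.
rewrite ge0_integral_iidS; last 2 first.
  by apply/measurable_EFinP; exact: measurable_sqnorm_shift.
  by move=> y; rewrite lee_fin sqnorm_ge0.
(* This is the constant term of the outer integrand, whose sign [integral_lincomb] asks for. *)
have G0 : 0 <= sqnorm (behead_cv v) + k%:R * m2.
  by apply: integral_fin_ge0 (IHk (behead_cv v)) => y; exact: sqnorm_ge0.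
(* The zero multiple pads the integrand to the three-term shape of [integral_lincomb]. *)
transitivity (\int[D]_x ((v ord0 ord0 + x) ^+ 2 + 0 * (v ord0 ord0 + x) ^+ 2
    + (sqnorm (behead_cv v) + k%:R * m2))%:E)%E.
  apply: eq_integral => x _.
  transitivity (\int[iid D k]_y (sqnorm (behead_cv v + y)
      + 0 * sqnorm (behead_cv v + y) + (v ord0 ord0 + x) ^+ 2)%:E)%E.
    by apply: eq_integral => y _; rewrite add_cons_cv sqnorm_cons_cv/=; congr EFin; ring.
  rewrite (integral_lincomb _ _ _ _ _ _ (IHk _) (IHk _)) ?sqr_ge0//.
  - by congr EFin; ring.
  - exact: measurable_sqnorm_shift.
  - by move=> y; exact: sqnorm_ge0.
  - exact: measurable_sqnorm_shift.
  - by move=> y; exact: sqnorm_ge0.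
rewrite (integral_lincomb _ _ _ _ _ _ (moment2 _) (moment2 _))//.
- by congr EFin; rewrite sqnormS -natr1; ring.
- by move=> x; exact: sqr_ge0.
- by move=> x; exact: sqr_ge0.
Qed.

(** The squares [(v_i + y_i)^2] are independent, with mean [v_i^2 + m2] and variance
    [4 v_i^2 m2 + m4 - m2^2]. The right-hand side is the squared total mean [(|v|^2 + k m2)^2] plus
    the sum of these variances. *)
Lemma iid_moment4 k (v : 'cV[R]_k) :
  (\int[iid D k]_y (sqnorm (v + y) ^+ 2)%:E =
   (sqnorm v ^+ 2 + (2 * k%:R + 4) * m2 * sqnorm v
    + (k%:R * m4 + k%:R * (k%:R - 1) * m2 ^+ 2))%:E)%E.
Proof.
elim: k v => [|k IHk] v.
  under eq_integral do rewrite /sqnorm big_ord0 expr0n.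
  by rewrite integral0 /sqnorm big_ord0; congr EFin; ring.
rewrite ge0_integral_iidS; last 2 first.
  apply/measurable_EFinP; apply: measurable_funX; exact: measurable_sqnorm_shift.
  by move=> y; rewrite lee_fin sqr_ge0.
pose w := behead_cv v; pose c : R := v ord0 ord0.
have G0 : 0 <= sqnorm w + k%:R * m2.
  by apply: integral_fin_ge0 (iid_moment2 w) => y; exact: sqnorm_ge0.
have H0 := integral_fin_ge0 (fun y => sqr_ge0 _) (IHk w).
transitivity (\int[D]_x ((c + x) ^+ 4 + 2 * (sqnorm w + k%:R * m2) * (c + x) ^+ 2
    + (sqnorm w ^+ 2 + (2 * k%:R + 4) * m2 * sqnorm w
    + (k%:R * m4 + k%:R * (k%:R - 1) * m2 ^+ 2)))%:E)%E.
  apply: eq_integral => x _.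
  transitivity (\int[iid D k]_y (sqnorm (w + y) ^+ 2
      + 2 * (c + x) ^+ 2 * sqnorm (w + y) + (c + x) ^+ 4)%:E)%E.
    apply: eq_integral => y _; rewrite add_cons_cv sqnorm_cons_cv/= -/c -/w.
    by congr EFin; ring.
  have p0 : 0 <= 2 * (c + x) ^+ 2 by rewrite mulr_ge0// sqr_ge0.
  have q0 : 0 <= (c + x) ^+ 4 by rewrite exprn_even_ge0.
  rewrite (integral_lincomb _ _ _ _ p0 q0 (IHk _) (iid_moment2 _))//.
  - by congr EFin; ring.
  - by apply: measurable_funX; exact: measurable_sqnorm_shift.
  - by move=> y; exact: sqr_ge0.
  - exact: measurable_sqnorm_shift.
  - by move=> y; exact: sqnorm_ge0.
rewrite (integral_lincomb _ _ _ _ _ _ (moment4 _) (moment2 _)) ?mulr_ge0//.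
- by congr EFin; rewrite (sqnormS v) -natr1 -/c -/w; ring.
- by move=> x; rewrite exprn_even_ge0.
- by move=> x; exact: sqr_ge0.
Qed.

End moments.

(** Shifting one coordinate costs [expR (r * |v_i|)], and these factors multiply to the exponential
    of the l1-norm. *)
Lemma iid_translate_le (r : R) :
  (forall (v : R) (f : R -> \bar R), measurable_fun [set: R] f ->
     (forall x, (0 <= f x)%E) ->
     (\int[D]_x f (v + x)%R <= (expR (r * `|v|))%:E * \int[D]_x f x)%E) ->
  forall k (v : 'cV[R]_k) (f : 'cV[R]_k -> \bar R),
    measurable_fun [set: 'cV[R]_k] f -> (forall y, (0 <= f y)%E) ->
    (\int[iid D k]_y f (v + y)%R <=
     (expR (r * l1norm v))%:E * \int[iid D k]_y f y)%E.
Proof.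
move=> D_le; elim=> [|k IHk] v f mf f0.
  rewrite /l1norm big_ord0 mulr0 expR0 mul1e.
  by under eq_integral do rewrite (flatmx0 v) add0r.
have mfv : measurable_fun [set: 'cV[R]_k.+1] (fun y => f (v + y)).
  by apply: measurableT_comp => //; exact: measurable_mxD.
rewrite !ge0_integral_iidS//.
have mfc : measurable_fun [set: R * 'cV[R]_k] (f \o @cons_cv R k).
  by apply: measurableT_comp => //; exact: measurable_cons_cv.
have mfc1 x : measurable_fun [set: 'cV[R]_k] (fun y => f (cons_cv (x, y))).
  by apply: (measurableT_comp mfc); exact: pair1_measurable.
pose g x := (\int[iid D k]_y f (cons_cv (x, y)))%E.
have mg : measurable_fun [set: R] g.
  by apply: (measurable_fun_fubini_tonelli_F (f \o @cons_cv R k)) => //= p.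
have g0 x : (0 <= g x)%E by exact: integral_ge0.
rewrite l1normS mulrDr expRD EFinM -muleA muleCA.
(* In the intermediate term the shift of the tail is already paid for while the first coordinate is
   still shifted: [D_le], applied to the partial integral [g], removes that shift, and the induction
   hypothesis at each fixed [x] handles the tail. *)
apply: (@le_trans _ _ ((expR (r * l1norm (behead_cv v)))%:E *
    \int[D]_x g (v ord0 ord0 + x)%R)%E); last first.
  by rewrite lee_wpmul2l ?lee_fin ?expR_ge0// D_le.
have mgv : measurable_fun [set: R] (fun x => g (v ord0 ord0 + x)).
  by apply: measurableT_comp => //; exact: measurable_funD.
rewrite -ge0_integralZl_EFin ?expR_ge0//.
apply: ge0_le_integral => //.
- by move=> x _; exact: integral_ge0.
- have mv2 : measurable_fun [set: R * 'cV[R]_k] (fun p => f (v + cons_cv p)).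
    by apply: (measurableT_comp mfv); exact: measurable_cons_cv.
  by apply: (measurable_fun_fubini_tonelli_F (fun p => f (v + cons_cv p))).
- exact: measurable_funeM.
- move=> x _; under eq_integral do rewrite add_cons_cv/=.
  exact: (IHk _ (fun y => f (cons_cv (v ord0 ord0 + x, y)))).
Qed.

End iid_noise.

(** * Laplace law of arbitrary scale *)

Section laplace_noise.
Context {R : realType}.

Definition dilation (b : R) (x : measurableTypeR R) : R := b * x.

Lemma measurable_dilation b : measurable_fun [set: measurableTypeR R] (dilation b).
Proof. exact: measurable_funM. Qed.

HB.instance Definition _ b :=
  isMeasurableFun.Build _ _ _ _ (dilation b) (measurable_dilation b).

Definition laplace (b : R) : probability R R :=
  distribution (@laplace_prob R) (dilation b).

Lemma ge0_integral_dilation (b : R) (f : R -> \bar R) :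
  measurable_fun [set: R] f -> (forall x, (0 <= f x)%E) ->
  (\int[laplace b]_x f x = \int[@laplace_prob R]_x f (b * x)%R)%E.
Proof. by move=> mf f0; rewrite ge0_integral_distribution. Qed.

(* Symmetrizing removes the odd powers of x, so that all the integrands stay
   nonnegative. *)
Lemma laplace_symmetrize (f : R -> R) :
  measurable_fun [set: R] f -> (forall x, 0 <= f x) ->
  (\int[@laplace_prob R]_x (f x)%:E =
   \int[@laplace_prob R]_x (2^-1 * (f x + f (- x)))%:E)%E.
Proof.
move=> mf f0.
have mfN : measurable_fun [set: R] (fun x => f (- x)).
  by apply: measurableT_comp => //; exact: oppr_measurable.
under [RHS]eq_integral do rewrite EFinM EFinD.
rewrite ge0_integralZl_EFin//=; last 2 first.
- by move=> x _; rewrite -EFinD lee_fin addr_ge0.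
- by apply: emeasurable_funD; apply/measurable_EFinP.
rewrite ge0_integralD//=; last 4 first.
- by move=> x _; rewrite lee_fin.
- exact/measurable_EFinP.
- by move=> x _; rewrite lee_fin.
- exact/measurable_EFinP.
rewrite (laplace_symmetric (f := EFin \o f))//=; last exact/measurable_EFinP.
set I := (\int[_]_x _)%E.
have I0 : (0 <= I)%E by apply: integral_ge0 => x _; rewrite lee_fin.
rewrite ge0_muleDr// -ge0_muleDl ?lee_fin// -EFinD.
by rewrite (_ : 2^-1 + 2^-1 = 1 :> R) ?mul1e//; lra.
Qed.

Lemma laplace_moment2 (b c : R) :
  (\int[laplace b]_x ((c + x) ^+ 2)%:E = (c ^+ 2 + 2 * b ^+ 2)%:E)%E.
Proof.
rewrite ge0_integral_dilation; last 2 first.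
- by apply/measurable_EFinP; apply: measurable_funX; exact: measurable_funD.
- by move=> x; rewrite lee_fin sqr_ge0.
rewrite laplace_symmetrize; last 2 first.
- by apply: measurable_funX; apply: measurable_funD => //; exact: measurable_funM.
- by move=> x; exact: sqr_ge0.
have m2 : (\int[@laplace_prob R]_x (x ^+ 2)%:E = 2%:E)%E :=
  @laplace_even_moment R 2 isT.
transitivity (\int[@laplace_prob R]_x
    (0 * x ^+ 2 + b ^+ 2 * x ^+ 2 + c ^+ 2)%:E)%E.
  by apply: eq_integral => x _; congr EFin; field.
have mX n : measurable_fun [set: R] (fun x : R => x ^+ n) by exact: exprn_measurable.
have f0 : (\int[@laplace_prob R]_x (0 * x ^+ 2)%:E = 0%:E)%E.
  by under eq_integral do rewrite mul0r; rewrite integral0.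
rewrite (@integral_lincomb _ _ R laplace_prob (fun x : R => 0 * x ^+ 2)
  (fun x : R => x ^+ 2) 0 2 _ _ _ _ _ _ _ _ f0 m2) ?sqr_ge0//.
- by congr EFin; ring.
- by apply: measurable_funM => //; exact: mX.
- by move=> x; rewrite mul0r.
- by move=> x; rewrite sqr_ge0.
Qed.

Lemma laplace_moment4 (b c : R) :
  (\int[laplace b]_x ((c + x) ^+ 4)%:E =
   (c ^+ 4 + 6 * c ^+ 2 * (2 * b ^+ 2) + 24 * b ^+ 4)%:E)%E.
Proof.
rewrite ge0_integral_dilation; last 2 first.
- by apply/measurable_EFinP; apply: measurable_funX; exact: measurable_funD.
- by move=> x; rewrite lee_fin exprn_even_ge0.
rewrite laplace_symmetrize; last 2 first.
- by apply: measurable_funX; apply: measurable_funD => //; exact: measurable_funM.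
- by move=> x; rewrite exprn_even_ge0.
have m2 : (\int[@laplace_prob R]_x (x ^+ 2)%:E = 2%:E)%E :=
  @laplace_even_moment R 2 isT.
have m4 : (\int[@laplace_prob R]_x (x ^+ 4)%:E = 24%:E)%E :=
  @laplace_even_moment R 4 isT.
transitivity (\int[@laplace_prob R]_x
    (b ^+ 4 * x ^+ 4 + 6 * c ^+ 2 * b ^+ 2 * x ^+ 2 + c ^+ 4)%:E)%E.
  by apply: eq_integral => x _; congr EFin; field.
have b4 : 0 <= b ^+ 4 by rewrite exprn_even_ge0.
have m4b : (\int[@laplace_prob R]_x (b ^+ 4 * x ^+ 4)%:E = (b ^+ 4 * 24)%:E)%E.
  under eq_integral do rewrite EFinM.
  rewrite ge0_integralZl_EFin// ?m4//.
  - by move=> x _; rewrite lee_fin exprn_even_ge0.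
  - by apply/measurable_EFinP; exact: exprn_measurable.
rewrite (@integral_lincomb _ _ R laplace_prob (fun x : R => b ^+ 4 * x ^+ 4)
  (fun x : R => x ^+ 2) _ _ _ _ _ _ _ _ _ _ m4b m2).
- by congr EFin; ring.
- by apply: measurable_funM => //; exact: exprn_measurable.
- by move=> x; rewrite mulr_ge0// exprn_even_ge0.
- exact: exprn_measurable.
- by move=> x; exact: sqr_ge0.
- by rewrite mulr_ge0 ?sqr_ge0// mulr_ge0 ?sqr_ge0.
- by rewrite exprn_even_ge0.
Qed.

Lemma laplace_dilation_translate_le (b : R) : 0 < b ->
  forall (v : R) (f : R -> \bar R),
  measurable_fun [set: R] f -> (forall x, (0 <= f x)%E) ->
  (\int[laplace b]_x f (v + x)%R <=
   (expR (b^-1 * `|v|))%:E * \int[laplace b]_x f x)%E.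
Proof.
move=> b0 v f mf f0.
have mfv : measurable_fun [set: R] (fun x => f (v + x)).
  by apply: measurableT_comp => //; exact: measurable_funD.
rewrite !ge0_integral_dilation//.
rewrite (_ : b^-1 * `|v| = `|v / b|); last first.
  by rewrite normrM normfV (gtr0_norm b0) mulrC.
have vE x : v + b * x = b * (v / b + x).
  by rewrite mulrDr mulrCA divff ?mulr1// gt_eqF.
under eq_integral do rewrite vE.
apply: (@laplace_translate_le R (v / b) (fun x => f (b * x))) => //.
by apply: measurableT_comp => //; exact: measurable_funM.
Qed.

End laplace_noise.

(** * Count-Sketch matrices *)

Section count_sketch.
Context {R : realType}.

Definition signed_units k : seq 'cV[R]_k :=
  [seq (-1) ^+ (b : bool) *: delta_mx i ord0 | i <- enum 'I_k, b <- [:: false; true]].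

Definition cons_col k d (c : 'cV[R]_k) (M : 'M[R]_(k, d)) : 'M[R]_(k, d.+1) :=
  \matrix_(i, j) if unlift ord0 j is Some l then M i l else c i ord0.

Lemma col0_cons_col k d (c : 'cV[R]_k) (M : 'M[R]_(k, d)) :
  col ord0 (cons_col c M) = c.
Proof. by apply/matrixP => i j; rewrite !mxE unlift_none (ord1 j). Qed.

Lemma col_lift_cons_col k d (c : 'cV[R]_k) (M : 'M[R]_(k, d)) (l : 'I_d) :
  col (lift ord0 l) (cons_col c M) = col l M.
Proof. by apply/matrixP => i j; rewrite !mxE liftK. Qed.

(* All the matrices with signed unit columns: a uniform draw from this list makes
   the columns independent and uniform. *)
Fixpoint count_sketches k d : seq 'M[R]_(k, d) :=
  if d is d'.+1 then [seq cons_col c M | c <- signed_units k, M <- count_sketches k d']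
  else [:: 0].

Definition signed_unit_columns k d (M : 'M[R]_(k, d)) : Prop :=
  forall j, col j M \in signed_units k.

Lemma signed_unitsP k (c : 'cV[R]_k) : c \in signed_units k ->
  exists i (b : bool), c = (-1) ^+ b *: delta_mx i ord0.
Proof. by case/allpairsP=> -[i b] [_ _ ->]; exists i, b. Qed.

Lemma size_signed_units k : size (signed_units k) = (k * 2)%N.
Proof. by rewrite size_allpairs size_enum_ord. Qed.

Lemma size_count_sketches_gt0 k d : (0 < k)%N -> (0 < size (count_sketches k d))%N.
Proof.
by move=> k0; elim: d => //= d IHd; rewrite size_allpairs size_signed_units !muln_gt0 k0.
Qed.

Lemma count_sketches_columns k d (M : 'M[R]_(k, d)) :
  M \in count_sketches k d -> signed_unit_columns M.
Proof.
elim: d M => [|d IHd] M; first by move=> _ [].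
case/allpairsP=> -[c M'] [/= cU M'C ->] j.
have [l ->|->] := unliftP ord0 j; last by rewrite col0_cons_col.
by rewrite col_lift_cons_col; exact: IHd.
Qed.

Lemma mulmx_cons_col k d (c : 'cV[R]_k) (M : 'M[R]_(k, d)) (z : 'cV[R]_d.+1) :
  cons_col c M *m z = z ord0 ord0 *: c + M *m behead_cv z.
Proof.
apply/matrixP => i j; rewrite ord1 !mxE big_ord_recl !mxE unlift_none mulrC.
by congr (_ + _); apply: eq_bigr => l _; rewrite !mxE liftK.
Qed.

Lemma sqnorm_unit_add k (a : R) (i : 'I_k) (u : 'cV[R]_k) :
  sqnorm (a *: delta_mx i ord0 + u) = a ^+ 2 + 2 * a * u i ord0 + sqnorm u.
Proof.
rewrite /sqnorm (bigD1 i)//= [in RHS](bigD1 i)//= !mxE !eqxx mulr1.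
rewrite (eq_bigr (fun l => u l ord0 ^+ 2)); first by ring.
by move=> l /negbTE li; rewrite !mxE li mulr0 add0r.
Qed.

Lemma big_signed_units k (F : 'cV[R]_k -> R) :
  \sum_(c <- signed_units k) F c =
  \sum_i (F (delta_mx i ord0) + F (- delta_mx i ord0)).
Proof.
rewrite /signed_units big_allpairs_dep big_enum/=; apply: eq_bigr => i _.
by rewrite !big_cons big_nil addr0 expr0 scale1r expr1 scaleN1r.
Qed.

Lemma sum_sqnorm_signed_units k (a : R) (u : 'cV[R]_k) :
  \sum_(c <- signed_units k) sqnorm (a *: c + u) =
  (k * 2)%:R * (a ^+ 2 + sqnorm u).
Proof.
rewrite big_signed_units (eq_bigr (fun=> 2 * (a ^+ 2 + sqnorm u))); last first.
  by move=> i _; rewrite scalerN -scaleNr !sqnorm_unit_add; ring.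
by rewrite sumr_const card_ord -mulr_natl natrM; ring.
Qed.

(** With [A = a^2 + |u|^2] and [B = 2 a u_i], opposite signs contribute
    [(A + B)^2 + (A - B)^2 = 2 A^2 + 2 B^2]; the terms [2 B^2 = 8 a^2 u_i^2] then add up over [i] to
    the last summand. *)
Lemma sum_sqnorm2_signed_units k (a : R) (u : 'cV[R]_k) :
  \sum_(c <- signed_units k) sqnorm (a *: c + u) ^+ 2 =
  (k * 2)%:R * (a ^+ 2 + sqnorm u) ^+ 2 + 8 * a ^+ 2 * sqnorm u.
Proof.
rewrite big_signed_units (eq_bigr (fun i =>
  2 * (a ^+ 2 + sqnorm u) ^+ 2 + 8 * a ^+ 2 * u i ord0 ^+ 2)); last first.
  by move=> i _; rewrite scalerN -scaleNr !sqnorm_unit_add; ring.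
rewrite big_split/= sumr_const card_ord -mulr_sumr -/(sqnorm u).
by rewrite -mulr_natl natrM; ring.
Qed.

Lemma sum_sqnorm_count_sketches k d (z : 'cV[R]_d) :
  \sum_(M <- count_sketches k d) sqnorm (M *m z) =
  (size (count_sketches k d))%:R * sqnorm z.
Proof.
elim: d z => [|d IHd] z.
  by rewrite big_seq1 mul0mx mul1r /sqnorm big_ord0 big1// => i _; rewrite mxE expr0n.
rewrite /= big_allpairs_dep/= exchange_big/=.
under eq_bigr do under eq_bigr do rewrite mulmx_cons_col.
under eq_bigr do rewrite sum_sqnorm_signed_units.
rewrite -mulr_sumr big_split/= IHd big_const_seq count_predT iter_addr_0.
by rewrite size_allpairs size_signed_units sqnormS [in RHS]natrM -mulr_natl; ring.
Qed.

(** The bound [E |S z|^4 <= (1 + 2/k) |z|^4], cleared of its denominators. The cross term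
    [a^2 |y|^2] appears with the same coefficient on both sides, so the induction loses only in
    [a^4]. *)
Lemma sum_sqnorm2_count_sketches k d (z : 'cV[R]_d) :
  k%:R * \sum_(M <- count_sketches k d) sqnorm (M *m z) ^+ 2 <=
  (size (count_sketches k d))%:R * (k%:R + 2) * sqnorm z ^+ 2.
Proof.
elim: d z => [|d IHd] z.
  rewrite big_seq1 mul0mx /sqnorm big_ord0 big1 => [|i _]; last by rewrite mxE expr0n.
  by rewrite expr0n !mulr0.
rewrite /= big_allpairs_dep/= exchange_big/=.
under eq_bigr do under eq_bigr do rewrite mulmx_cons_col.
under eq_bigr do rewrite sum_sqnorm2_signed_units.
pose a : R := z ord0 ord0; pose y := behead_cv z; rewrite -/a -/y.
rewrite (eq_bigr (fun M => ((k * 2)%:R * a ^+ 4 +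
    ((k * 2)%:R * 2 + 8) * a ^+ 2 * sqnorm (M *m y)) +
    (k * 2)%:R * sqnorm (M *m y) ^+ 2)); last by move=> M _; ring.
rewrite !big_split/= -!mulr_sumr sum_sqnorm_count_sketches.
rewrite big_const_seq count_predT iter_addr_0 size_allpairs size_signed_units.
rewrite -[a *+ _]mulr_natr sqnormS -/a -/y !natrM.
move: (IHd y); set N := (size _)%:R; set Q := \sum_(M <- _) _ => QN.
have a4 : 0 <= a ^+ 4 by rewrite exprn_even_ge0.
have N0 : 0 <= N by rewrite ler0n.
have k0 : 0 <= k%:R :> R by rewrite ler0n.
have := ler_wpM2l (mulr_ge0 k0 (ler0n R 2)) QN.
(* This is exactly the gap between the two sides once the induction hypothesis is used: a single
   column preserves the norm, so its [a^4] carries the factor [1] where the bound allows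
   [1 + 2/k]. *)
have : 0 <= k%:R * 2 * N * 2 * a ^+ 4 by rewrite mulr_ge0// !mulr_ge0.
by lra.
Qed.

Lemma l1norm_signed_unit k (c : 'cV[R]_k) : c \in signed_units k -> l1norm c = 1.
Proof.
case/signed_unitsP=> i [b ->]; rewrite /l1norm (bigD1 i)//= !mxE !eqxx mulr1 normr_sign.
rewrite big1 ?addr0// => l /negbTE li.
by rewrite !mxE li mulr0 normr0.
Qed.

Lemma l1norm_mulmx k d (M : 'M[R]_(k, d)) (z : 'cV[R]_d) :
  signed_unit_columns M -> l1norm (M *m z) <= l1norm z.
Proof.
move=> MU; apply: (@le_trans _ _ (\sum_i \sum_j `|M i j| * `|z j ord0|)).
  apply: ler_sum => i _; rewrite mxE (le_trans (ler_norm_sum _ _ _))//.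
  by apply: ler_sum => j _; rewrite normrM.
rewrite exchange_big/=; apply: ler_sum => j _; rewrite -mulr_suml.
rewrite (_ : \sum_i _ = l1norm (col j M)); last by apply: eq_bigr => i _; rewrite mxE.
by rewrite l1norm_signed_unit ?mul1r.
Qed.

Lemma column_sparse1 k d (M : 'M[R]_(k, d)) :
  signed_unit_columns M -> column_sparse 1 M.
Proof.
move=> MU j; have [i [b Mj]] := signed_unitsP (MU j).
rewrite /l0norm Mj; apply: leq_trans (eq_leq (card1 i)).
apply/subset_leq_card/fintype.subsetP => l.
rewrite !inE !mxE; apply: contraNT => /negbTE li.
by rewrite li mulr0.
Qed.

End count_sketch.

(** * Moments of the estimator *)

Section uniform_index.
Context {R : realType}.

(** The uniform law on [0, ..., n]. It lives on [nat], all of whose subsets are measurable, so that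
    a random matrix can be any function of the index. *)
Definition uniform_index n : set nat -> \bar R :=
  mscale (n.+1%:R^-1)%:nng (msum (fun i => \d_i) n.+1).

HB.instance Definition _ n := Measure.on (uniform_index n).

Lemma ge0_integral_uniform_index n (f : nat -> R) : (forall i, 0 <= f i) ->
  (\int[uniform_index n]_i (f i)%:E = (n.+1%:R^-1 * \sum_(i < n.+1) f i)%:E)%E.
Proof.
move=> f0; have fE0 i : (0 <= (f i)%:E)%E by rewrite lee_fin.
rewrite ge0_integral_mscale//= ge0_integral_measure_sum// EFinM -sumEFin.
by congr (_ * _)%E; apply: eq_bigr => i _; rewrite integral_dirac//= diracT mul1e.
Qed.

Let uniform_index_setT n : uniform_index n [set: nat] = 1%E.
Proof.
rewrite -[LHS]mul1e -(integral_cst (uniform_index n))//.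
rewrite (@ge0_integral_uniform_index n (cst 1))//.
by rewrite sumr_const card_ord mulVf// pnatr_eq0.
Qed.

HB.instance Definition _ n :=
  @Measure_isProbability.Build _ _ R (uniform_index n) (uniform_index_setT n).

End uniform_index.

(** Passes from raw moments of a nonnegative variable to the mean and variance of the recentred one;
    the constant [c] cancels in the deviation from the mean. *)
Lemma unbiased_and_variance d (T : measurableType d) (R : realType)
    (P : probability T R) (F : T -> R) (a b c : R) :
  measurable_fun [set: T] F -> (forall w, 0 <= F w) ->
  (\int[P]_w (F w)%:E = a%:E)%E -> (\int[P]_w (F w ^+ 2)%:E = b%:E)%E ->
  unbiased_estimator P (fun w => F w - c) (a - c) /\
  'V_P[fun w => F w - c] = (b - a ^+ 2)%:E.
Proof.
move=> mF F0 Fa Fb.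
have mFE : measurable_fun [set: T] (EFin \o F) by exact/measurable_EFinP.
have a0 : 0 <= a by exact: integral_fin_ge0 Fa.
have iF : P.-integrable [set: T] (EFin \o F).
  apply/integrableP; split=> //.
  under eq_integral do rewrite /= ger0_norm//.
  by rewrite Fa ltry.
have ic : P.-integrable [set: T] (EFin \o cst c) by exact: finite_measure_integrable_cst.
have E : ('E_P[fun w => (F w - c)%R] = (a - c)%:E)%E.
  rewrite unlock; under eq_integral do rewrite EFinB.
  by rewrite integralB_EFin// Fa integral_cst//= probability_setT mule1.
split.
  split=> //; rewrite (_ : _ \o _ = (EFin \o F) \- (EFin \o cst c))%E//.
  exact: integrableB.
rewrite /variance covariance.unlock E/=.
rewrite [X in ('E_P[X])%E](_ : _ = fun w => (F w - a) ^+ 2); last first.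
  by apply/funext => w; rewrite !fctE expr2; congr (_ * _); rewrite /=; ring.
rewrite unlock.
have mFa : measurable_fun [set: T] (fun w => (F w - a) ^+ 2).
  by apply: measurable_funX; exact: measurable_funB.
(* Adding [2 * a * F w] makes the expanded square a nonnegative combination. *)
have : (\int[P]_w ((F w - a) ^+ 2 + 2 * a * F w)%:E = (b + a ^+ 2)%:E)%E.
  under eq_integral.
    move=> w _; rewrite (_ : _ + _ = F w ^+ 2 + 0 * F w + a ^+ 2); last by ring.
    over.
  rewrite (integral_lincomb _ _ _ _ _ _ Fb Fa) ?sqr_ge0//.
  - by congr EFin; ring.
  - exact: measurable_funX.
  - by move=> w; rewrite sqr_ge0.
under eq_integral do rewrite EFinD (EFinM (2 * a)).
have Z : (\int[P]_w ((2 * a)%:E * (F w)%:E) = (2 * a * a)%:E)%E.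
  rewrite ge0_integralZl_EFin ?mulr_ge0//; first by rewrite Fa.
  by move=> w _; rewrite lee_fin.
rewrite ge0_integralD//=.
- rewrite Z; set I := (\int[P]_w _)%E => H.
  rewrite -(@addeK _ (2 * a * a)%:E I)// H -EFinB.
  by congr EFin; ring.
- by move=> w _; rewrite lee_fin sqr_ge0.
- exact/measurable_EFinP.
- by move=> w _; rewrite -EFinM lee_fin !mulr_ge0.
- by apply: measurable_funeM.
Qed.

Section noise_difference.
Context {R : realType} (D : probability R R) (m2 m4 : R) (k : nat).
Hypothesis moment2 : forall c, (\int[D]_x ((c + x) ^+ 2)%:E = (c ^+ 2 + m2)%:E)%E.
Hypothesis moment4 : forall c,
  (\int[D]_x ((c + x) ^+ 4)%:E = (c ^+ 4 + 6 * c ^+ 2 * m2 + m4)%:E)%E.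
Let Dk := iid D k.

Let m2_ge0 : 0 <= m2.
Proof.
have := moment2 0; rewrite expr0n add0r => /integral_fin_ge0; apply=> x.
exact: sqr_ge0.
Qed.

Let m4_ge0 : 0 <= m4.
Proof.
have := moment4 0; rewrite !expr0n !(mulr0, mul0r) !add0r => /integral_fin_ge0.
by apply=> x; rewrite exprn_even_ge0.
Qed.

Let measurable_diff (v : 'cV[R]_k) :
  measurable_fun [set: 'cV[R]_k * 'cV[R]_k] (fun p => sqnorm (v + p.1 - p.2)).
Proof.
apply: measurable_sqnorm; apply: measurable_mxD.
  by apply: measurable_mxD => //; exact: measurable_fst.
apply: measurable_fun_mx => i j; under [X in measurable_fun _ X]eq_fun do rewrite mxE.
apply: measurableT_comp; first exact: oppr_measurable.
by apply: (measurableT_comp (measurable_mx_entry i j)); exact: measurable_snd.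
Qed.

Lemma diff_moment2 (v : 'cV[R]_k) :
  (\int[Dk \x Dk]_p (sqnorm (v + p.1 - p.2))%:E = (sqnorm v + k%:R * m2 *+ 2)%:E)%E.
Proof.
rewrite fubini_tonelli1/=; last 2 first.
- by apply/measurable_EFinP; exact: measurable_diff.
- by move=> p; rewrite lee_fin sqnorm_ge0.
have G := @iid_moment2 _ _ _ moment2 k v.
transitivity (\int[Dk]_y (sqnorm (v + y) + 0 * sqnorm (v + y) + k%:R * m2)%:E)%E.
  apply: eq_integral => y _; rewrite /fubini_F/=.
  (* Since the norm is even, subtracting the second noise from [v + y] amounts to adding it to
     [- (v + y)], and the one-noise formula holds around any centre. *)
  under eq_integral do rewrite -sqnormN opprB addrC.
  by rewrite (iid_moment2 moment2) sqnormN mul0r addr0.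
rewrite (integral_lincomb _ _ _ _ _ _ G G) ?mulr_ge0//.
- by congr EFin; rewrite mulr2n; ring.
- exact: measurable_sqnorm_shift.
- by move=> y; exact: sqnorm_ge0.
- exact: measurable_sqnorm_shift.
- by move=> y; exact: sqnorm_ge0.
Qed.

Lemma diff_moment4 (v : 'cV[R]_k) :
  (\int[Dk \x Dk]_p (sqnorm (v + p.1 - p.2) ^+ 2)%:E =
   (sqnorm v ^+ 2 + (4 * k%:R + 8) * m2 * sqnorm v +
    (2 * k%:R * m4 + (4 * k%:R ^+ 2 + 2 * k%:R) * m2 ^+ 2))%:E)%E.
Proof.
rewrite fubini_tonelli1/=; last 2 first.
- by apply/measurable_EFinP; apply: measurable_funX; exact: measurable_diff.
- by move=> p; rewrite lee_fin sqr_ge0.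
pose C := k%:R * m4 + k%:R * (k%:R - 1) * m2 ^+ 2.
have C0 : 0 <= C.
  have kk : 0 <= k%:R * (k%:R - 1) :> R.
    by case: (k) => [|n]; rewrite ?mul0r// -[n.+1%:R in X in _ * X]natr1 addrK mulr_ge0.
  by rewrite addr_ge0// mulr_ge0// sqr_ge0.
have G := @iid_moment2 _ _ _ moment2 k v.
have H := @iid_moment4 _ _ _ _ moment2 moment4 k v.
(* After the second noise is integrated out, the moments of [v + y] yield the linear coefficient
   [(2k + 4) m2] a second time and the constant [2 C + (2k + 4) m2 * (k m2)]. *)
transitivity (\int[Dk]_y (sqnorm (v + y) ^+ 2
   + (2 * k%:R + 4) * m2 * sqnorm (v + y) + C)%:E)%E.
  apply: eq_integral => y _; rewrite /fubini_F/=.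
  under eq_integral do rewrite -sqnormN opprB addrC.
  by rewrite (iid_moment4 moment2 moment4) sqnormN.
have p0 : 0 <= (2 * k%:R + 4) * m2 by rewrite mulr_ge0// addr_ge0// mulr_ge0.
rewrite (integral_lincomb _ _ _ _ p0 C0 H G).
- by congr EFin; rewrite /C; ring.
- by apply: measurable_funX; exact: measurable_sqnorm_shift.
- by move=> y; exact: sqr_ge0.
- exact: measurable_sqnorm_shift.
- by move=> y; exact: sqnorm_ge0.
Qed.

End noise_difference.

(** * Programs *)

Section programs.
Context {R : realType}.
Implicit Types st : state R.

(** The first array name beyond those of the memory layout, so that loops disturb none of the stored
    data. *)
Definition aCounter := 7%N.

Definition counter : iexp := IGet aCounter (INat 0).

Definition for_loop (n : iexp) (body : cmd) : cmd :=
  Seq (ISet aCounter (INat 0) (INat 0))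
    (While (ILt counter n)
      (Seq body (ISet aCounter (INat 0) (IAdd counter (INat 1))))).

Definition set_counter st v : state R :=
  State (upd (imem st) aCounter 0 v) (rmem st) (tape st).

(** In the bound, [3] is the initialization, [icost n + 3] the cost of each of the [N.+1] tests, and
    [6] that of an increment. The guard reevaluates [n] every time, hence the hypothesis that the
    invariant fixes its value. *)
Lemma runs_for_loop (n : iexp) (body : cmd) (c N : nat)
    (Inv : nat -> state R -> Prop) st :
  (forall i st v, Inv i st -> Inv i (set_counter st v)) ->
  (forall i st, Inv i st -> ieval st n = N) ->
  (forall i st, (i < N)%N -> imem st aCounter 0 = i -> Inv i st ->
     runs_within body st c (fun st' => imem st' aCounter 0 = i /\ Inv i.+1 st')) ->
  Inv 0%N st ->
  runs_within (for_loop n body) st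
    (3 + (icost n + 3) * N.+1 + N * (c + 6))%N (Inv N).
Proof.
move=> Inv_counter nN bodyP I0.
(* Generalized to an arbitrary starting index, for an induction on the number [m] of remaining
   iterations. *)
suff loopP m i st' : (i + m = N)%N -> imem st' aCounter 0 = i -> Inv i st' ->
    exists t st'', [/\ exec (While (ILt counter n)
      (Seq body (ISet aCounter (INat 0) (IAdd counter (INat 1))))) st' t st'',
      (t <= (icost n + 3) * m.+1 + m * (c + 6))%N & Inv N st''].
  have [t [st' [ex tle IN]]] := loopP N 0%N (set_counter st 0) (add0n _) erefl
    (Inv_counter _ _ _ I0).
  exists (3 + t)%N, st'; split=> //.
  by apply: ExSeq ex; exact: ExISet.
elim: m i st' => [|m IHm] i st' im ci Ii.
  exists (tcost (ILt counter n)), st'; split.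
  - by apply: ExWhileF; rewrite /= ci (nN _ _ Ii) -im addn0 ltnn.
  - by rewrite /= muln1; lia.
  - by rewrite -im addn0.
have iN : (i < N)%N by lia.
have [t1 [st1 [ex1 t1le [c1 I1]]]] := bodyP _ _ iN ci Ii.
have [||t2 [st2 [ex2 t2le I2]]] :=
    IHm i.+1 (set_counter st1 (imem st1 aCounter 0 + 1)) _ _ (Inv_counter _ _ _ I1).
- by lia.
- by rewrite /= /upd/= c1 addn1.
exists (tcost (ILt counter n) + (t1 + 6) + t2)%N, st2; split=> //.
- apply: (ExWhileT _ _ ex2); first by rewrite /= ci (nN _ _ Ii).
  by apply: (ExSeq ex1); exact: ExISet.
- by rewrite /=; nia.
Qed.

(* The programs write only to the counter and to one real array. *)
Definition agree_off (r : nat) st st' : Prop :=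
  (forall a i, (a < aCounter)%N -> imem st' a i = imem st a i) /\
  (forall a i, a != r -> rmem st' a i = rmem st a i).

Lemma agree_off_trans r st2 st1 st3 :
  agree_off r st1 st2 -> agree_off r st2 st3 -> agree_off r st1 st3.
Proof.
by move=> [i1 r1] [i2 r2]; split=> a i ha; [rewrite i2// i1|rewrite r2// r1].
Qed.

Lemma agree_off_set_counter r st v : agree_off r st (set_counter st v).
Proof.
by split=> a i //= ha; rewrite /upd; case: eqP => [E|//]; rewrite E ltnn in ha.
Qed.

Lemma agree_off_upd r st i v ws :
  agree_off r st (State (imem st) (upd (rmem st) r i v) ws).
Proof. by split=> a j //= /negbTE ar; rewrite /upd ar. Qed.

Lemma holds_matrix_agree k d st st' s (S : 'M[R]_(k, d)) :
  agree_off aU st st' -> holds_matrix st s S -> holds_matrix st' s S.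
Proof.
move=> [ii rr] [hk hs hS]; split; rewrite ?ii// => j.
have [l [ul lE lidx lval]] := hS j; exists l; split=> //.
- by rewrite -lidx (ii aCount)//; apply: eq_mkseq => t; rewrite ii.
- by rewrite -lval (ii aCount)//; apply: eq_mkseq => t; rewrite rr.
Qed.

Lemma sparse_vectorP n (v : 'cV[R]_n) size_v idx value :
  sparse_vector v size_v idx value ->
  exists l : seq 'I_n, [/\ uniq l, l =i [pred i | v i ord0 != 0], size_v = size l
    & forall t (i0 : 'I_n), (t < size l)%N ->
        idx t = nth i0 l t /\ value t = v (nth i0 l t) ord0].
Proof.
case=> l [ul lE lidx lval]; have sl : size_v = size l.
  by rewrite -(size_map val l) -lidx size_mkseq.
exists l; split=> // t i0 tl; split.
- have := congr1 (fun s => nth 0%N s t) lidx.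
  by rewrite /= nth_mkseq ?sl// (nth_map i0).
- have := congr1 (fun s => nth 0 s t) lval.
  by rewrite /= nth_mkseq ?sl// (nth_map i0).
Qed.

(** At sparsity 1 the slot of column [j] is position [j] itself, and its support is a single row, so
    the stored list has one element. The programs can therefore treat a column with a single
    assignment. *)
Lemma holds_matrix_unit_column k d st (S : 'M[R]_(k, d)) (j : 'I_d) :
  signed_unit_columns S -> holds_matrix st 1 S ->
  exists i : 'I_k, [/\ imem st aRow j = i, rmem st aVal j = S i j
    & forall i', i' != i -> S i' j = 0].
Proof.
move=> SU [_ _ /(_ j) /sparse_vectorP[l [ul lE _ lP]]].
have [i [b Sj]] := signed_unitsP (SU j).
have SE i' : S i' j = (-1) ^+ b * (i' == i)%:R.
  by have := congr1 (fun c : 'cV_k => c i' ord0) Sj; rewrite !mxE eqxx andbT.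
have li : l = [:: i].
  apply: perm_small_eq => //; apply: uniq_perm => // i'.
  rewrite lE !inE mxE SE; case: (eqVneq i' i) => _; last by rewrite mulr0 eqxx.
  by rewrite mulr1 signr_eq0.
have [] := lP 0%N i; first by rewrite li.
rewrite li/= muln1 addn0 mxE => ri vi; exists i; split=> // i' /negbTE ii'.
by rewrite SE ii' mulr0.
Qed.

Definition update : cmd :=
  let row := IGet aRow (IGet aJ (INat 0)) in
  RSet aU row (RAdd (RGet aU row)
    (RMul (RGet aA (INat 0)) (RGet aVal (IGet aJ (INat 0))))).

Lemma update_correct k d (S : 'M[R]_(k, d)) :
  signed_unit_columns S -> updates_sketch_within update (64 * 1) 1 S.
Proof.
move=> SU x eta j a st [hS hU] hj ha.
have [i [ri vi zi]] := holds_matrix_unit_column j SU hS.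
eexists; eexists; split; first exact: ExRSet.
  by [].
split; first exact: (holds_matrix_agree (agree_off_upd _ _ _ _ _) hS).
move=> i'; rewrite /= hj ri ha vi hU /upd /= /sketch mulmxDr addrAC [RHS]mxE.
have E : (S *m (a *: delta_mx j ord0 : 'cV[R]_d)) i' ord0 = a * S i' j.
  rewrite !mxE (bigD1 j)//= !mxE !eqxx mulr1 big1 ?addr0 1?mulrC// => l /negbTE lj.
  by rewrite !mxE lj !mulr0.
rewrite E hU /sketch; case: ifPn => [/eqP/val_inj->//|ii].
by rewrite zi ?mulr0 ?addr0.
Qed.

(** The noise is drawn directly into the sketch array, which then serves as the accumulator for
    [S *m x]. *)
Definition draw_noise : cmd := for_loop (IGet aK (INat 0)) (Draw aU counter).

Definition add_column : cmd :=
  let j := IGet aXIdx counter in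
  let row := IGet aRow j in
  RSet aU row (RAdd (RGet aU row) (RMul (RGet aXVal counter) (RGet aVal j))).

Definition add_columns : cmd := for_loop (IGet aXSize (INat 0)) add_column.

Definition compute : cmd := Seq draw_noise add_columns.

Lemma draw_noise_correct k st (eta : 'cV[R]_k) :
  imem st aK 0 = k -> tape st = [seq eta i ord0 | i <- enum 'I_k] ->
  runs_within draw_noise st (8 + 14 * k)
    (fun st' => agree_off aU st st' /\ holds_vector st' aU eta).
Proof.
move=> hk ht; pose etas := [seq eta i ord0 | i <- enum 'I_k].
have sz : size etas = k by rewrite size_map size_enum_ord.
pose Inv i st' := [/\ agree_off aU st st', tape st' = drop i etas
  & forall j, (j < i)%N -> rmem st' aU j = nth 0 etas j].
have [||||t [st' [ex tle [ag _ hU]]]] :=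
    @runs_for_loop (IGet aK (INat 0)) (Draw aU counter) 3 k Inv st.
- move=> i st1 v [ag tp hU]; split=> //.
  exact: agree_off_trans ag (agree_off_set_counter _ _ _).
- by move=> i st1 [[ii _] _ _]; rewrite /= ii.
- move=> i st1 ik ci [ag tp hU].
  rewrite (drop_nth 0) ?sz// in tp.
  exists 3%N; eexists; split; [exact: ExDraw tp|by []|split=> //].
  split=> //; first exact: agree_off_trans ag (agree_off_upd _ _ _ _ _).
  move=> j; rewrite ltnS leq_eqVlt /= ci /upd/= => /predU1P[->|ji].
    by rewrite eqxx.
  by rewrite ltn_eqF// hU.
- by split=> //; rewrite drop0.
exists t, st'; split=> //; first by move: tle => /=; lia.
split=> // i; rewrite hU// (nth_map i) ?size_enum_ord//.
by rewrite nth_ord_enum.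
Qed.

Lemma add_columns_correct k d (S : 'M[R]_(k, d)) (x : 'cV[R]_d) (eta : 'cV[R]_k) st :
  signed_unit_columns S -> holds_matrix st 1 S -> holds_sparse_input st x ->
  holds_vector st aU eta ->
  runs_within add_columns st (8 + 30 * l0norm x)
    (fun st' => agree_off aU st st' /\ holds_vector st' aU (sketch S x eta)).
Proof.
move=> SU hS /sparse_vectorP[l [ul lE sl lP]] hU.
have szl : size l = l0norm x by rewrite /l0norm -(eq_card lE); exact/esym/card_uniqP.
pose Inv p st' := agree_off aU st st' /\
  forall i : 'I_k, rmem st' aU i = eta i ord0 + \sum_(j <- take p l) S i j * x j ord0.
have [||||t [st' [ex tle [ag hU']]]] :=
    @runs_for_loop (IGet aXSize (INat 0)) add_column 19 (size l) Inv st.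
- move=> p st1 v [ag hU1]; split=> //.
  exact: agree_off_trans ag (agree_off_set_counter _ _ _).
- by move=> p st1 [[ii _] _]; rewrite /= ii.
- move=> p st1 pl cp [ag hU1].
  (* A default element for [nth]: ['I_d] is inhabited here because the list has a [p]-th element. *)
  have [j0 _] : exists j0 : 'I_d, True by case: (l) pl => // j0 _ _; exists j0.
  have [idxp valp] := lP p j0 pl; set j := nth j0 l p in idxp valp.
  have hS1 := holds_matrix_agree ag hS.
  have [i [ri vi zi]] := holds_matrix_unit_column j SU hS1.
  have [ii rr] := ag.
  exists 19%N; eexists; split; [exact: ExRSet|by []|split=> //].
  split; first exact: agree_off_trans ag (agree_off_upd _ _ _ _ _).
  move=> i'; rewrite /= cp (ii aXIdx)// idxp ri vi (rr aXVal)// valp /upd/=.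
  rewrite (take_nth j0)// -cats1 big_cat/= big_seq1 -/j.
  case: ifPn => [/eqP/val_inj->|ii']; first by rewrite hU1 -addrA [x _ _ * _]mulrC.
  by rewrite hU1 zi ?mul0r ?addr0.
- by split=> // i; rewrite take0 big_nil addr0.
exists t, st'; split=> //; first by move: tle; rewrite szl/=; lia.
split=> // i; rewrite hU' take_size /sketch !mxE addrC; congr (_ + _).
(* The loop has summed over the support of [x] only; the other terms of the matrix product
   vanish. *)
rewrite big_uniq//= (eq_bigl [pred j | x j ord0 != 0])//.
rewrite [RHS](bigID [pred j | x j ord0 != 0])/=.
by rewrite [X in _ + X]big1 ?addr0// => j /negPn/eqP ->; rewrite mulr0.
Qed.

Lemma compute_correct k d (S : 'M[R]_(k, d)) : (0 < k)%N ->
  signed_unit_columns S ->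
  computes_sketch_within compute (fun x => 64 * (1 * l0norm x + k))%N 1 S.
Proof.
move=> k0 SU x eta st hS hx ht; have [hk _ _] := hS.
have [t1 [st1 [ex1 t1le [ag1 hU1]]]] := draw_noise_correct hk ht.
have [ii rr] := ag1.
have hx1 : holds_sparse_input st1 x.
  have [l [ul lE lidx lval]] := hx; exists l; split=> //.
  - by rewrite -lidx (ii aXSize)//; apply: eq_mkseq => t; rewrite ii.
  - by rewrite -lval (ii aXSize)//; apply: eq_mkseq => t; rewrite rr.
have [t2 [st2 [ex2 t2le [ag2 hU2]]]] :=
  add_columns_correct SU (holds_matrix_agree ag1 hS) hx1 hU1.
exists (t1 + t2)%N, st2; split; [exact: ExSeq ex1 ex2|lia|split=> //].
exact: holds_matrix_agree (agree_off_trans ag1 ag2) hS.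
Qed.

Definition add_square : cmd :=
  let diff := RSub (RGet aU counter) (RGet aV counter) in
  RSet aOut (INat 0) (RAdd (RGet aOut (INat 0)) (RMul diff diff)).

Definition estimate : cmd :=
  let eps := RGet aEps (INat 0) in
  Seq (RSet aOut (INat 0) (RNat (INat 0)))
    (Seq (for_loop (IGet aK (INat 0)) add_square)
      (RSet aOut (INat 0) (RSub (RGet aOut (INat 0))
        (RDiv (RMul (RMul (RNat (INat 4)) (RNat (IGet aK (INat 0))))
                    (RNat (IGet aS (INat 0))))
              (RMul eps eps))))).

Lemma estimate_correct k d s (eps : R) (S : 'M[R]_(k, d)) : (0 < k)%N ->
  computes_estimator_within estimate (64 * k) s eps S.
Proof.
move=> k0 x y eta mu st hk hs he.
set u := sketch S x eta; set v := sketch S y mu => hu hv.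
pose st0 : state R := State (imem st) (upd (rmem st) aOut 0 0) (tape st).
have ag0 : agree_off aOut st st0 by exact: agree_off_upd.
pose Inv p st' := agree_off aOut st st' /\
  rmem st' aOut 0 = \sum_(i < k | (i < p)%N) (u i ord0 - v i ord0) ^+ 2.
have [||||t [st' [ex tle [ag hO]]]] :=
    @runs_for_loop (IGet aK (INat 0)) add_square 20 k Inv st0.
- move=> p st1 w [ag hO]; split=> //.
  exact: agree_off_trans ag (agree_off_set_counter _ _ _).
- by move=> p st1 [[ii _] _]; rewrite /= ii.
- move=> p st1 pk cp [ag hO]; have [ii rr] := ag.
  exists 20%N; eexists; split; [exact: ExRSet|by []|split=> //].
  split; first exact: agree_off_trans ag (agree_off_upd _ _ _ _ _).
  rewrite /= cp hO rr// rr// /upd/=.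
  rewrite (hu (Ordinal pk)) (hv (Ordinal pk)) [RHS](bigD1 (Ordinal pk))//= addrC -expr2.
  congr (_ + _); apply: eq_bigl => i; rewrite ltnS -val_eqE/= [RHS]andbC.
  by rewrite [RHS]andbC ltn_neqAle andbC.
- by split=> //; rewrite big_pred0.
have [ii rr] := ag.
exists (4 + (t + 21))%N; eexists; split.
- by apply: ExSeq; [exact: ExRSet|apply: ExSeq; [exact: ex|exact: ExRSet]].
(* The loop takes at most [31 k + 8] steps, so the total is at most [31 k + 33], which is below
   [64 k] because [k >= 1]. This is the program that determines the constant 64. *)
- by move: tle => /=; lia.
rewrite /= /upd/= hO !ii// hk hs rr// he /E_SJLT l2norm_sqr -expr2; congr (_ - _).
rewrite /sqnorm (eq_bigl xpredT) => [|i]; last by rewrite ltn_ord.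
by apply: eq_bigr => i _; rewrite !mxE.
Qed.

End programs.

(** * Random sketches *)

Section random_sketch.
Context {R : realType} {dT : measure_display} {T : measurableType dT}.
Variables (k d : nat) (P : probability T R) (S : {mfun T >-> 'M[R]_(k, d)}).

Lemma measurable_sketch dV (V : measurableType dV) (t : V -> T)
    (eta : V -> 'cV[R]_k) (x : 'cV[R]_d) :
  measurable_fun [set: V] t -> measurable_fun [set: V] eta ->
  measurable_fun [set: V] (fun w => sketch (S (t w)) x (eta w)).
Proof.
move=> mt meta; apply: measurable_mxD => //; apply: measurable_fun_mx => i j.
under [X in measurable_fun _ X]eq_fun do rewrite mxE.
apply: measurable_sum => l; apply: measurable_funM => //.
apply: (measurableT_comp (measurable_mx_entry i l)).
by apply: measurableT_comp.
Qed.

Section moments.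
Variables (D : probability R R) (m2 m4 q : R) (z : 'cV[R]_d).
Hypothesis moment2 : forall c, (\int[D]_x ((c + x) ^+ 2)%:E = (c ^+ 2 + m2)%:E)%E.
Hypothesis moment4 : forall c,
  (\int[D]_x ((c + x) ^+ 4)%:E = (c ^+ 4 + 6 * c ^+ 2 * m2 + m4)%:E)%E.
Hypothesis isometric : (\int[P]_t (sqnorm (S t *m z))%:E = (sqnorm z)%:E)%E.
Hypothesis second_moment : (\int[P]_t (sqnorm (S t *m z) ^+ 2)%:E = q%:E)%E.
Let Dk := iid D k.
Let DkDk : probability ('cV[R]_k * 'cV[R]_k)%type R := (Dk \x Dk)%E.
Let F (w : T * ('cV[R]_k * 'cV[R]_k)) := sqnorm (S w.1 *m z + w.2.1 - w.2.2).

Lemma measurable_sqnorm_diff : measurable_fun [set: T * ('cV[R]_k * 'cV[R]_k)] F.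
Proof.
apply: measurable_sqnorm; apply: measurable_mxD.
  apply: (@measurable_sketch _ _ fst (fun w => w.2.1) z) => //.
  by apply: measurableT_comp => //; exact: measurable_fst.
apply: measurable_fun_mx => i j; under [X in measurable_fun _ X]eq_fun do rewrite mxE.
apply: measurableT_comp; first exact: oppr_measurable.
apply: (measurableT_comp (measurable_mx_entry i j)).
by apply: measurableT_comp.
Qed.

Let measurable_Sz : measurable_fun [set: T] (fun t => sqnorm (S t *m z)).
Proof.
apply: measurable_sqnorm.
under [X in measurable_fun _ X]eq_fun do rewrite -[_ *m _]addr0.
exact: (@measurable_sketch _ _ id (cst 0) z).
Qed.

Lemma sqnorm_diff_moment2 :
  (\int[P \x (Dk \x Dk)]_w (F w)%:E = (sqnorm z + k%:R * m2 *+ 2)%:E)%E.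
Proof.
rewrite (@fubini_tonelli1 _ _ _ _ R P DkDk (EFin \o F))/=; last 2 first.
- by apply/measurable_EFinP; exact: measurable_sqnorm_diff.
- by move=> w; rewrite lee_fin sqnorm_ge0.
have k0 : 0 <= k%:R * m2 *+ 2.
  have := integral_fin_ge0 _ (@diff_moment2 _ _ _ k moment2 0).
  rewrite /sqnorm big1 ?add0r; first by apply=> p; exact: sqnorm_ge0.
  by move=> i _; rewrite mxE expr0n.
transitivity (\int[P]_t (sqnorm (S t *m z) + 0 * sqnorm (S t *m z)
    + k%:R * m2 *+ 2)%:E)%E.
  apply: eq_integral => t _; rewrite mul0r addr0.
  exact: (diff_moment2 moment2 (S t *m z)).
rewrite (integral_lincomb _ _ _ _ _ _ isometric isometric)//.
- by congr EFin; ring.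
- by move=> t; exact: sqnorm_ge0.
- by move=> t; exact: sqnorm_ge0.
Qed.

(** Tonelli integrates the noise first, with [S t *m z] as a fixed centre; the outer integral then
    involves only the first two moments of [|S z|^2]. *)
Lemma sqnorm_diff_moment4 :
  (\int[P \x (Dk \x Dk)]_w (F w ^+ 2)%:E =
   (q + (4 * k%:R + 8) * m2 * sqnorm z +
    (2 * k%:R * m4 + (4 * k%:R ^+ 2 + 2 * k%:R) * m2 ^+ 2))%:E)%E.
Proof.
rewrite (@fubini_tonelli1 _ _ _ _ R P DkDk (fun w => (F w ^+ 2)%:E))/=; last 2 first.
- by apply/measurable_EFinP; apply: measurable_funX; exact: measurable_sqnorm_diff.
- by move=> w; rewrite lee_fin sqr_ge0.
have m20 : 0 <= m2.
  have := moment2 0; rewrite expr0n add0r => /integral_fin_ge0; apply=> x.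
  exact: sqr_ge0.
(* The constant is the value of the noise integral at centre zero, hence nonnegative. *)
have C0 : 0 <= 2 * k%:R * m4 + (4 * k%:R ^+ 2 + 2 * k%:R) * m2 ^+ 2.
  have := integral_fin_ge0 _ (@diff_moment4 _ _ _ _ k moment2 moment4 0).
  rewrite /sqnorm big1 ?expr0n ?mulr0 ?add0r; first by apply=> p; exact: sqr_ge0.
  by move=> i _; rewrite mxE expr0n.
have p0 : 0 <= (4 * k%:R + 8) * m2 by rewrite mulr_ge0// addr_ge0// mulr_ge0.
transitivity (\int[P]_t (sqnorm (S t *m z) ^+ 2
    + (4 * k%:R + 8) * m2 * sqnorm (S t *m z)
    + (2 * k%:R * m4 + (4 * k%:R ^+ 2 + 2 * k%:R) * m2 ^+ 2))%:E)%E.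
  by apply: eq_integral => t _; exact: (diff_moment4 moment2 moment4 (S t *m z)).
rewrite (integral_lincomb _ _ _ _ p0 C0 second_moment isometric)//.
- exact: measurable_funX.
- by move=> t; exact: sqr_ge0.
- by move=> t; exact: sqnorm_ge0.
Qed.

End moments.

(** For fixed [t], the sketch of [x] is that of [y] with the noise shifted by [S t *m (x - y)], a
    vector of l1-norm at most 1. The resulting bound is uniform in [t] and survives integration over
    [P]. *)
Lemma sketch_private (D : probability R R) (eps : R) : 0 <= eps ->
  (forall (v : R) (f : R -> \bar R), measurable_fun [set: R] f ->
     (forall x, (0 <= f x)%E) ->
     (\int[D]_x f (v + x)%R <= (expR (eps * `|v|))%:E * \int[D]_x f x)%E) ->
  (forall t, signed_unit_columns (S t)) ->
  differentially_private (P \x iid D k)%E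
    (fun (x : 'cV[R]_d) (w : T * 'cV[R]_k) => (S w.1, sketch (S w.1) x w.2)) eps 0.
Proof.
move=> eps0 D_le SU; set M := fun x w => _.
have mM x : measurable_fun [set: T * 'cV[R]_k] (M x).
  apply: measurable_fun_pair; first exact: measurableT_comp.
  by apply: measurable_sketch.
split=> // x y xy A mA; rewrite adde0.
pose g (p : 'M[R]_(k, d) * 'cV[R]_k) : \bar R := (\1_A p)%:E.
have mg : measurable_fun [set: 'M[R]_(k, d) * 'cV[R]_k] g.
  by apply/measurable_EFinP; exact: measurable_indic.
have g0 p : (0 <= g p)%E by rewrite lee_fin.
have PrE u : ((P \x iid D k) (M u @^-1` A) =
    \int[P]_t \int[iid D k]_e g (S t, sketch (S t) u e))%E.
  have mMA : measurable (M u @^-1` A) by rewrite -[X in measurable X]setTI; exact: mM.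
  rewrite -[in LHS](setIT (M u @^-1` A)) -integral_indic//.
  have mgM : measurable_fun [set: T * 'cV[R]_k] (g \o M u) by exact: measurableT_comp.
  exact: (fubini_tonelli1 (g \o M u) mgM (fun w => g0 (M u w))).
suff : (\int[P]_t \int[iid D k]_e g (S t, sketch (S t) x e) <= (expR eps)%:E *
    \int[P]_t \int[iid D k]_e g (S t, sketch (S t) y e))%E by rewrite -!PrE.
rewrite -ge0_integralZl_EFin ?expR_ge0//; last 2 first.
- by move=> t _; exact: integral_ge0.
- apply: (measurable_fun_fubini_tonelli_F (fun w => g (M y w))) => //.
  exact: measurableT_comp.
apply: ge0_le_integral => //.
- by move=> t _; exact: integral_ge0.
- apply: (measurable_fun_fubini_tonelli_F (fun w => g (M x w))) => //.
  exact: measurableT_comp.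
- apply: measurable_funeM.
  apply: (measurable_fun_fubini_tonelli_F (fun w => g (M y w))) => //.
  exact: measurableT_comp.
move=> t _.
pose f e := g (S t, sketch (S t) y e).
have mf : measurable_fun [set: 'cV[R]_k] f.
  apply: (measurableT_comp mg); apply: measurable_fun_pair => //.
  by apply: measurable_sketch.
have fE e : g (S t, sketch (S t) x e) = f (S t *m (x - y) + e).
  by rewrite /f /sketch mulmxBr addrA addrCA subrr addr0.
under eq_integral do rewrite fE.
apply: le_trans (iid_translate_le D_le (S t *m (x - y)) mf (fun e => g0 _)) _.
apply: lee_wpmul2r; first by apply: integral_ge0 => e _; exact: g0.
rewrite lee_fin ler_expR.
rewrite -[leRHS]mulr1 ler_wpM2l//.
exact: le_trans (l1norm_mulmx _ (SU t)) xy.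
Qed.

End random_sketch.

Section uniform_count_sketch.
Context {R : realType}.
Variables k d : nat.
Let sketches := @count_sketches R k d.

(* Out-of-range indices, of probability 0, still yield an admissible matrix, as the
   sparsity bound is required of every outcome. *)
Definition count_sketch (i : nat) : 'M[R]_(k, d) := nth (head 0 sketches) sketches i.

Let measurable_count_sketch : measurable_fun [set: nat] count_sketch.
Proof. by []. Qed.

HB.instance Definition _ :=
  isMeasurableFun.Build _ _ _ _ count_sketch measurable_count_sketch.

Hypothesis k_gt0 : (0 < k)%N.
Let sketches_gt0 : (0 < size sketches)%N := size_count_sketches_gt0 d k_gt0.

Lemma count_sketch_columns i : signed_unit_columns (count_sketch i).
Proof.
apply: (@count_sketches_columns _ k d); rewrite /count_sketch -/sketches.
have [il|li] := ltnP i (size sketches); first exact: mem_nth.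
by rewrite nth_default// -nth0 mem_nth.
Qed.

(** The predecessor appears because [uniform_index n] charges [n.+1] indices; [k_gt0] makes the list
    nonempty. *)
Lemma integral_count_sketch (F : 'M[R]_(k, d) -> R) : (forall M, 0 <= F M) ->
  (\int[uniform_index (size sketches).-1]_i (F (count_sketch i))%:E =
   ((size sketches)%:R^-1 * \sum_(M <- sketches) F M)%:E)%E.
Proof.
move=> F0; rewrite (@ge0_integral_uniform_index _ _ (fun i => F (count_sketch i)))//.
by rewrite prednK// (big_nth (head 0 sketches)) big_mkord.
Qed.

Lemma count_sketch_isometric (z : 'cV[R]_d) :
  (\int[uniform_index (size sketches).-1]_i (sqnorm (count_sketch i *m z))%:E =
   (sqnorm z)%:E)%E.
Proof.
rewrite (integral_count_sketch (F := fun M => sqnorm (M *m z))); last first.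
  by move=> M; exact: sqnorm_ge0.
by rewrite sum_sqnorm_count_sketches mulKf// pnatr_eq0 -lt0n.
Qed.

(** The exact moment [q] is kept beside its bound because [unbiased_and_variance] takes exact
    values. *)
Lemma count_sketch_moment2 (z : 'cV[R]_d) : exists2 q,
  (\int[uniform_index (size sketches).-1]_i (sqnorm (count_sketch i *m z) ^+ 2)%:E =
   q%:E)%E & q <= (1 + 2 / k%:R) * sqnorm z ^+ 2.
Proof.
eexists; first by apply: (integral_count_sketch (F := fun M => sqnorm (M *m z) ^+ 2)) =>
  M; exact: sqr_ge0.
have kR : 0 < k%:R :> R by rewrite ltr0n.
rewrite ler_pdivrMl ?ltr0n// -(ler_pM2l kR).
apply: le_trans (sum_sqnorm2_count_sketches k z) _.
by rewrite le_eqVlt; apply/orP; left; apply/eqP; field; rewrite gt_eqF.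
Qed.

End uniform_count_sketch.

(** * Choice of the parameters and assembly *)

Lemma E_SJLT_sketchE (R : realType) k d (s : nat) (eps : R) (S : 'M[R]_(k, d))
    (x y : 'cV[R]_d) (eta mu : 'cV[R]_k) :
  E_SJLT s eps (sketch S x eta) (sketch S y mu) =
  sqnorm (S *m (x - y) + eta - mu) - 4 * k%:R * s%:R / eps ^+ 2.
Proof.
rewrite /E_SJLT l2norm_sqr /sketch mulmxBr; congr (sqnorm _ - _).
by rewrite opprD addrACA addrA.
Qed.

(** From [ln beta <= beta - 1] one gets [ln (1 / beta) >= 1 / 2], and each inverse power of [alpha]
    is at least 2. The first bound admits [s = 1]; the second lets rounding up cost only a factor 2
    in [k]. *)
Lemma sketch_dimension_bounds (R : realType) (alpha beta : R) :
  0 < alpha < 1 / 2 -> 0 < beta < 1 / 2 ->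
  1 <= alpha^-1 * ln (1 / beta) /\ 1 <= alpha ^- 2 * ln (1 / beta).
Proof.
move=> /andP[a0 a1] /andP[b0 b1].
have L : 1 / 2 <= ln (1 / beta).
  rewrite (div1r beta) lnV ?posrE//.
  have : ln (1 + (beta - 1)) <= beta - 1 by apply: le_ln1Dx; lra.
  by rewrite addrC subrK; lra.
have V : 2 <= alpha^-1 by rewrite -div1r ler_pdivlMr//; lra.
have V2 : 2 <= alpha ^- 2.
  by rewrite -exprVn expr2; nra.
by split; nra.
Qed.

Theorem theorem3 (R : realType) :
  exists (D : nat -> R -> probability R R) (update compute estimate : cmd)
         (cl cu cs cv : R) (ct : nat),
    [/\ 0 < cl, 0 < cu, 0 < cs & 0 < cv] /\
  forall (alpha beta eps : R) (d : nat),
    0 < alpha < 1 / 2 -> 0 < beta < 1 / 2 -> 0 < eps -> (0 < d)%N ->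
  exists (k s : nat) (dT : measure_display) (T : measurableType dT)
         (P : probability T R) (S : {mfun T >-> 'M[R]_(k, d)}),
    [/\ cl * (alpha ^- 2 * ln (1 / beta)) <= k%:R
          <= cu * (alpha ^- 2 * ln (1 / beta)),
        s%:R <= cs * (alpha^-1 * ln (1 / beta)) &
        forall w : T, column_sparse s (S w)] /\
    (* w.1 is the randomness of S, w.2.1 is eta and w.2.2 is mu *)
    let Dk := iid (D s eps) k in
    let PN := (P \x (Dk \x Dk))%E in
    let Ehat := fun (x y : 'cV[R]_d) (w : T * ('cV[R]_k * 'cV[R]_k)) =>
      E_SJLT s eps (sketch (S w.1) x w.2.1) (sketch (S w.1) y w.2.2) in
    [/\ forall x y : 'cV[R]_d,
          unbiased_estimator PN (Ehat x y) (l2norm (x - y) ^+ 2),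
        forall x y : 'cV[R]_d,
          ('V_PN[Ehat x y] <=
            (2 / k%:R * l2norm (x - y) ^+ 4 +
             cv * (s%:R / eps ^+ 2 * l2norm (x - y) ^+ 2 +
                   s%:R ^+ 2 / eps ^+ 4 * k%:R))%:E)%E,
        differentially_private (P \x Dk)%E
          (fun (x : 'cV[R]_d) (w : T * 'cV[R]_k) =>
             (S w.1, sketch (S w.1) x w.2)) eps 0,
        forall w : T, updates_sketch_within update (ct * s) s (S w) &
        forall w : T,
          computes_sketch_within compute
            (fun x : 'cV[R]_d => (ct * (s * l0norm x + k))%N) s (S w) /\
          computes_estimator_within estimate (ct * k) s eps (S w)].
Proof.
exists (fun s eps => laplace (Num.sqrt s%:R / eps)), update, compute, estimate.
(* Here 56 is the larger of the noise coefficients 16 and 56 in the variance, and 64 covers the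
   running times of all three programs. *)
exists 1, 2, 1, 56, 64%N; split; first by [].
move=> alpha beta eps d ha hb eps0 _.
have [L1 L2] := sketch_dimension_bounds ha hb; set L := alpha ^- 2 * _ in L2 *.
(* This [k] lies between [L] and [L + 1], and [L + 1 <= 2 * L] as [L >= 1]. *)
pose k := (Num.truncn L).+1.
exists k, 1%N, default_measure_display, nat.
exists (uniform_index (size (@count_sketches R k d)).-1), (@count_sketch R k d).
have k0 : (0 < k)%N by [].
have SU i : signed_unit_columns (@count_sketch R k d i) by exact: count_sketch_columns.
split.
  split.
  - rewrite mul1r ltW ?truncnS_gt//=.
    have : (Num.truncn L)%:R <= L by rewrite truncn_le (le_trans ler01).
    by move: L2; rewrite /k -[_.+1%:R]natr1; lra.
  - by rewrite mul1r.
  - by move=> i; apply: column_sparse1; exact: SU.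
have kR : 0 < k%:R :> R by rewrite ltr0n.
rewrite sqrtr1 div1r => Dk PN Ehat.
have EhatE x y : Ehat x y = fun w =>
    sqnorm (@count_sketch R k d w.1 *m (x - y) + w.2.1 - w.2.2)
    - 4 * k%:R / eps ^+ 2.
  by apply/funext => w; rewrite /Ehat E_SJLT_sketchE mulr1.
have moments x y : unbiased_estimator PN (Ehat x y) (l2norm (x - y) ^+ 2) /\
    exists2 q, q <= (1 + 2 / k%:R) * sqnorm (x - y) ^+ 2 &
      'V_PN[Ehat x y] = (q - sqnorm (x - y) ^+ 2
         + 16 * eps ^- 2 * sqnorm (x - y) + 56 * eps ^- 4 * k%:R)%:E.
  have [q Eq qle] := count_sketch_moment2 k0 (x - y).
  have m2P := laplace_moment2 eps^-1; have m4P := laplace_moment4 eps^-1.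
  have E2 := sqnorm_diff_moment2 m2P (count_sketch_isometric k0 (x - y)).
  have E4 := sqnorm_diff_moment4 m2P m4P (count_sketch_isometric k0 (x - y)) Eq.
  have [U V] := unbiased_and_variance (4 * k%:R / eps ^+ 2)
    (measurable_sqnorm_diff _ _) (fun w => sqnorm_ge0 _) E2 E4.
  rewrite EhatE; split.
    rewrite l2norm_sqr; move: U; congr unbiased_estimator.
    by rewrite exprVn; ring.
  (* With [m2 = 2 / eps^2] and [m4 = 24 / eps^4], subtracting the squared mean [(|z|^2 + 2 k m2)^2]
     leaves the linear coefficient [8 m2 = 16 / eps^2] and the constant
     [2 k (m4 + m2^2) = 56 k / eps^4]; the terms in [k^2] cancel. *)
  exists q => //; rewrite [LHS]V; congr EFin.
  by rewrite -[eps ^- 2]exprVn -[eps ^- 4]exprVn; ring.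
split.
- by move=> x y; have [] := moments x y.
- move=> x y; have [_ [q qle ->]] := moments x y.
  rewrite lee_fin (exprM (l2norm _) 2 2) l2norm_sqr.
  set z := sqnorm (x - y) in qle *.
  (* Allows raising the coefficient 16 of this term to the common constant 56. *)
  have : 0 <= eps ^- 2 * z by rewrite mulr_ge0 ?sqnorm_ge0// invr_ge0 sqr_ge0.
  by rewrite div1r expr1n; move: qle; lra.
- apply: sketch_private => //; first exact: ltW.
  have einv0 : 0 < eps^-1 by rewrite invr_gt0.
  by have := @laplace_dilation_translate_le R eps^-1 einv0; rewrite invrK.
- by move=> i; exact: (update_correct (SU i)).
- move=> i; split; first exact: (compute_correct k0 (SU i)).
  by apply: estimate_correct.
Qed.
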